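(* Let $H$ be a Hopf $^*$-algebra over $\mathsf{C}$. Within the class of idempotent and non-degenerate $^*$-algebras over $\mathsf{C}$ equipped with $^*$-actions of $H$, both $H$-covariant $^*$-Morita equivalence and $H$-covariant strong Morita equivalence are equivalence relations. Moreover, if two such $^*$-algebras $\mathcal{A}$ and $\mathcal{B}$ are $H$-equivariantly $^*$-isomorphic (i.e. there is a $^*$-isomorphism $\Phi:\mathcal{A}\to\mathcal{B}$ with $\Phi(g\triangleright a)=g\triangleright\Phi(a)$ for all $g\in H$, $a\in\mathcal{A}$), then they are $H$-covariantly strongly Morita equivalent and hence also $H$-covariantly $^*$-Morita equivalent.
   Context: **Ground ring.** $\mathsf{R}$ is an ordered ring (commutative, unital) and $\mathsf{C}=\mathsf{R}(i)$ with $i^2=-1$, with the obvious complex conjugation. A $^*$-algebra over $\mathsf{C}$ is an associative $\mathsf{C}$-algebra with a $\mathsf{C}$-antilinear involutive antiautomorphism $a\mapsto a^*$. It is *idempotent* if the products $ab$ span it, and *non-degenerate* if $a\mathcal{A}=0$ or $\mathcal{A}a=0$ implies $a=0$. For unital algebras, modules are unital and $^*$-homomorphisms preserve units. All modules carry a compatible $\mathsf{C}$-module structure. **Hopf $^*$-algebra.** $H$ is a Hopf algebra over $\mathsf{C}$ (comultiplication $\Delta(g)=g_{(1)}\otimes g_{(2)}$, counit $\epsilon$, antipode $S$) which is also a $^*$-algebra such that $\Delta,\epsilon$ are $^*$-homomorphisms and $S(S(g)^* )^*=g$. A $^*$-action of $H$ on $\mathcal{A}$ is a left $H$-module structure $\triangleright$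 (with $1_H\triangleright a=a$) with $g\triangleright(ab)=(g_{(1)}\triangleright a)(g_{(2)}\triangleright b)$, $(g\triangleright a)^*=S(g)^*\triangleright a^*$, and $g\triangleright 1=\epsilon(g)1$ if $\mathcal{A}$ is unital. **Positivity.** A linear functional $\omega:\mathcal{A}\to\mathsf{C}$ is positive if $\omega(a^*a)\ge 0$ for all $a$; $a\in\mathcal{A}$ is positive if $\omega(a)\ge0$ for all positive $\omega$. $M_n(\mathcal{A})$ is a $^*$-algebra in the usual way. **Inner products.** An $\mathcal{A}$-valued inner product on a right $\mathcal{A}$-module $\mathcal{E}$ is a $\mathsf{C}$-sesquilinear map (linear in the second argument) with $\langle x,y\cdot a\rangle=\langle x,y\rangle a$ and $\langle x,y\rangle=\langle y,x\rangle^*$; on a left module it is linear in the first argument and left linear there. It is non-degenerate if $\langle x,y\rangle=0$ for all $y$ implies $x=0$, full if its values span the algebra, completely positive if $(\langle x_i,x_j\rangle)_{ij}$ is a positive element of $M_n$ of the algebra for all $n$ and $x_1,\dots,x_n$. **Equivalence bimodules.** An $H$-covariant $^*$-equivalence bimodule for $\mathcal{B},\mathcal{A}$ is a $(\mathcal{B},\mathcal{A})$-bimodule $\mathcal{E}$ with $\mathcal{B}\cdot\mathcal{E}=\mathcal{E}=\mathcal{E}\cdot\mathcal{A}$ (spans), a full non-degenerate left $\mathcal{B}$-linear $\mathcal{B}$-valued inner product ${}_{\mathcal{B}}\langle\cdot,\cdot\rangle$ and a full non-degenerate right $\mathcal{A}$-linear $\mathcal{A}$-valued inner product $\langle\cdot,\cdot\rangle_{\mathcal{A}}$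 satisfying $\langle b\cdot x,y\rangle_{\mathcal{A}}=\langle x,b^*\cdot y\rangle_{\mathcal{A}}$, ${}_{\mathcal{B}}\langle x\cdot a,y\rangle={}_{\mathcal{B}}\langle x,y\cdot a^*\rangle$, ${}_{\mathcal{B}}\langle x,y\rangle\cdot z=x\cdot\langle y,z\rangle_{\mathcal{A}}$, together with an $H$-module structure on $\mathcal{E}$ such that $g\triangleright\langle x,y\rangle_{\mathcal{A}}=\langle S(g_{(1)})^*\triangleright x,g_{(2)}\triangleright y\rangle_{\mathcal{A}}$ and $g\triangleright{}_{\mathcal{B}}\langle x,y\rangle={}_{\mathcal{B}}\langle g_{(1)}\triangleright x,S(g_{(2)})^*\triangleright y\rangle$. It is an $H$-covariant strong equivalence bimodule if in addition both inner products are completely positive. $\mathcal{A}$ and $\mathcal{B}$ are $H$-covariantly $^*$-Morita (resp. strongly Morita) equivalent if such a bimodule exists. *)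

(* Defs.v *)
From HB Require Import structures.
From Stdlib Require Import RelationClasses.
From mathcomp Require Import all_boot all_order all_algebra.
From mathcomp Require Import generic_quotient boolp.
From mathcomp Require Import complex.

Set Implicit Arguments.
Unset Strict Implicit.
Unset Printing Implicit Defensive.

Import Order.TTheory GRing.Theory Num.Theory.
Local Open Scope ring_scope.
Local Open Scope quotient_scope.

(* C = R(i); an alias, as the ring structure on [complex R] requires R to be
   a field. *)
Definition cplx (R : realDomainType) : Type := complex R.

Section Cplx.
Variable R : realDomainType.

HB.instance Definition _ := GRing.Zmodule.copy (cplx R) (complex R).

Let one : cplx R := Complex 1 0.

Fact cplx_mul1 : left_id one (@ComplexField.mulc R).
Proof. by case=> a b; rewrite /= !mul1r !mul0r subr0 addr0. Qed.

Fact cplx_mulDl :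
  left_distributive (@ComplexField.mulc R) (@ComplexField.addc R).
Proof.
move=> [a b] [c d] [e f]; rewrite /= !mulrDl !opprD -!addrA.
by congr (Complex (_ + _) (_ + _)); rewrite addrCA.
Qed.

Fact cplx_oner_neq0 : one != 0.
Proof. by apply/eqP; case=> /eqP; rewrite oner_eq0. Qed.

HB.instance Definition _ := GRing.Zmodule_isComNzRing.Build (cplx R)
  (@ComplexField.mulcA R) (@ComplexField.mulcC R) cplx_mul1 cplx_mulDl
  cplx_oner_neq0.

Definition cconj (z : cplx R) : cplx R := Complex (complex.Re z) (- complex.Im z).

Definition cnonneg (z : cplx R) : bool := (complex.Im z == 0) && (0 <= complex.Re z).

(* c acts on V through its conjugate; [linear_for conj_scale] is antilinearity *)
Definition conj_scale (V : lmodType (cplx R)) (c : cplx R) (v : V) : V :=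
  cconj c *: v.

End Cplx.

Arguments conj_scale {R V} c v.

Section Multilinear.
Variable C : comNzRingType.

Definition linear_in_each (U V : lmodType C) (W : zmodType) (s s' : C -> W -> W)
    (f : U -> V -> W) : Prop :=
  (forall v, linear_for s (f^~ v)) /\ (forall u, linear_for s' (f u)).

Definition spanning (X Y : Type) (W : lmodType C) (f : X -> Y -> W) : Prop :=
  forall w, exists s : seq (C * (X * Y)),
    w = \sum_(p <- s) p.1 *: f p.2.1 p.2.2.

End Multilinear.

Notation bilinear2 f := (linear_in_each *:%R *:%R f).

Section Tensor.
Variables (C : comNzRingType) (U V : lmodType C).
Implicit Types s t : seq (U * V).

(* A list [:: (u_1, v_1); ...] stands for the formal sum of the u_i (x) v_i;
   no coefficients are needed, as c (u (x) v) = (c u) (x) v. *)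
Inductive tens_eqv : seq (U * V) -> seq (U * V) -> Prop :=
| tens_refl s : tens_eqv s s
| tens_sym s t : tens_eqv s t -> tens_eqv t s
| tens_trans s t r : tens_eqv s t -> tens_eqv t r -> tens_eqv s r
| tens_cat s s' t t' :
    tens_eqv s s' -> tens_eqv t t' -> tens_eqv (s ++ t) (s' ++ t')
| tens_catC s t : tens_eqv (s ++ t) (t ++ s)
| tens_0 v : tens_eqv [:: (0, v)] [::]
| tens_Dl u u' v : tens_eqv [:: (u + u', v)] [:: (u, v); (u', v)]
| tens_Dr u v v' : tens_eqv [:: (u, v + v')] [:: (u, v); (u, v')]
| tens_Z c u v : tens_eqv [:: (c *: u, v)] [:: (u, c *: v)].

Definition tens_rel : rel (seq (U * V)) := fun s t => `[< tens_eqv s t >].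

Fact tens_rel_refl : reflexive tens_rel.
Proof. by move=> s; apply/asboolP/tens_refl. Qed.

Fact tens_rel_sym : symmetric tens_rel.
Proof. by move=> s t; apply/asboolP/asboolP => /tens_sym. Qed.

Fact tens_rel_trans : transitive tens_rel.
Proof.
by move=> t s r /asboolP st /asboolP tr; apply/asboolP/(tens_trans st tr).
Qed.

Canonical tens_equiv :=
  EquivRel tens_rel tens_rel_refl tens_rel_sym tens_rel_trans.

Definition tensor : Type := {eq_quot tens_equiv}.
HB.instance Definition _ := Choice.on tensor.
HB.instance Definition _ := EqQuotient.on tensor.

Definition tens (u : U) (v : V) : tensor := \pi_tensor [:: (u, v)].

Lemma tens_piP s t : tens_eqv s t <-> \pi_tensor s = \pi_tensor t.
Proof.
split=> [st | /eqmodP]; first by apply/eqmodP; apply/asboolP.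
by move=> /asboolP.
Qed.

Lemma tens_repr s : tens_eqv (repr (\pi_tensor s)) s.
Proof. by apply/tens_piP; rewrite reprK. Qed.

Let scal c s : seq (U * V) := [seq (c *: p.1, p.2) | p <- s].

Let scal_eqv c s t : tens_eqv s t -> tens_eqv (scal c s) (scal c t).
Proof.
elim=> {s t} /=.
- by move=> s; apply: tens_refl.
- by move=> s t _; apply: tens_sym.
- by move=> s t r _ st _; apply: tens_trans.
- by move=> s s' t t' _ ss' _ tt'; rewrite /scal !map_cat; apply: tens_cat.
- by move=> s t; rewrite /scal !map_cat; apply: tens_catC.
- by move=> v; rewrite scaler0; apply: tens_0.
- by move=> u u' v; rewrite scalerDr; apply: tens_Dl.
- by move=> u v v'; apply: tens_Dr.
- by move=> d u v; rewrite scalerA mulrC -scalerA; apply: tens_Z.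
Qed.

Definition tens_zero : tensor := \pi_tensor [::].
Definition tens_add (x y : tensor) : tensor := \pi_tensor (repr x ++ repr y).
Definition tens_scale (c : C) (x : tensor) : tensor :=
  \pi_tensor (scal c (repr x)).
Definition tens_opp (x : tensor) : tensor := tens_scale (-1) x.

Let addE s t : tens_add (\pi_tensor s) (\pi_tensor t) = \pi_tensor (s ++ t).
Proof. by apply/tens_piP; apply: tens_cat; apply: tens_repr. Qed.

Let scaleE c s : tens_scale c (\pi_tensor s) = \pi_tensor (scal c s).
Proof. by apply/tens_piP/scal_eqv/tens_repr. Qed.

Let piW (P : tensor -> Prop) : (forall s, P (\pi_tensor s)) -> forall x, P x.
Proof. by move=> Ps x; rewrite -[x]reprK; apply: Ps. Qed.

Fact tens_addA : associative tens_add.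
Proof. by do 3!elim/piW => ?; rewrite !addE catA. Qed.

Fact tens_addC : commutative tens_add.
Proof. by do 2!elim/piW => ?; rewrite !addE; apply/tens_piP/tens_catC. Qed.

Fact tens_add0 : left_id tens_zero tens_add.
Proof. by elim/piW => ?; rewrite addE. Qed.

Fact tens_scaleDl x : {morph tens_scale^~ x : c d / c + d >-> tens_add c d}.
Proof.
elim/piW: x => s c d; rewrite !scaleE addE; apply/tens_piP.
elim: s => [|[u v] s IHs] /=; first exact: tens_refl.
rewrite -cat1s; apply: tens_trans (tens_cat _ IHs) _.
  by rewrite /= scalerDl; apply: tens_Dl.
rewrite -cat_cons -!(cat1s (_, v) (scal _ s)) -(cat1s (c *: u, v)) -!catA.
apply: tens_cat; first exact: tens_refl.
rewrite !catA; apply: tens_cat; last exact: tens_refl.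
exact: tens_catC.
Qed.

Fact tens_scale0 x : tens_scale 0 x = tens_zero.
Proof.
elim/piW: x => s; rewrite scaleE; apply/tens_piP.
elim: s => [|[u v] s IHs] /=; first exact: tens_refl.
by rewrite scale0r -cat1s; apply: (tens_cat (tens_0 v) IHs).
Qed.

Fact tens_scale1 : left_id 1 tens_scale.
Proof.
elim/piW => s; rewrite scaleE; congr (\pi_tensor _).
by rewrite -[RHS]map_id; apply: eq_map => -[u v] /=; rewrite scale1r.
Qed.

Fact tens_addN : left_inverse tens_zero tens_opp tens_add.
Proof.
move=> x; rewrite -[X in tens_add _ X]tens_scale1 /tens_opp -tens_scaleDl.
by rewrite addNr tens_scale0.
Qed.

HB.instance Definition _ :=
  GRing.isZmodule.Build tensor tens_addA tens_addC tens_add0 tens_addN.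

Fact tens_scaleA c d x : tens_scale c (tens_scale d x) = tens_scale (c * d) x.
Proof.
elim/piW: x => s; rewrite !scaleE /scal -map_comp; congr (\pi_tensor _).
by apply: eq_map => -[u v] /=; rewrite scalerA.
Qed.

Fact tens_scaleDr : right_distributive tens_scale +%R.
Proof.
move=> c; do 2!elim/piW => ?.
by rewrite /GRing.add /= addE !scaleE addE /scal map_cat.
Qed.

HB.instance Definition _ := GRing.Zmodule_isLmodule.Build C tensor
  tens_scaleA tens_scale1 tens_scaleDr tens_scaleDl.

Lemma tens_bilinear : bilinear2 tens.
Proof.
have tZ c u v : c *: tens u v = tens (c *: u) v by apply: scaleE.
split=> [v c u u' | u c v v']; rewrite tZ.
  by rewrite [RHS]addE; apply/tens_piP/tens_Dl.
rewrite [RHS]addE; apply/tens_piP; apply: tens_trans (tens_Dr _ _ _) _.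
exact: (tens_cat (tens_sym (tens_Z c u v)) (tens_refl [:: (u, v')])).
Qed.

(* Sweedler notation: the sum of f u_i v_i for any presentation of x as a sum
   of u_i (x) v_i; by [sweedlerE] the presentation does not matter as soon as
   f is biadditive and C-balanced. *)
Definition sweedler (W : zmodType) (f : U -> V -> W) (x : tensor) : W :=
  \sum_(p <- repr x) f p.1 p.2.

Lemma sweedlerE (W : zmodType) (f : U -> V -> W) s :
    (forall u u' v, f (u + u') v = f u v + f u' v) ->
    (forall u v v', f u (v + v') = f u v + f u v') ->
    (forall c u v, f (c *: u) v = f u (c *: v)) ->
  sweedler f (\pi_tensor s) = \sum_(p <- s) f p.1 p.2.
Proof.
move=> fDl fDr fZ; rewrite /sweedler.
move: (tens_repr s); move: (repr _) => t.
elim=> {s t} //=.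
- by move=> s t r _ st _; apply: etrans.
- by move=> s s' t t' _ ss' _ tt'; rewrite !big_cat /= ss' tt'.
- by move=> s t; rewrite !big_cat /= addrC.
- move=> v; rewrite big_seq1 big_nil /=.
  by apply: (addrI (f 0 v)); rewrite -fDl !addr0.
- by move=> u u' v; rewrite !big_cons !big_nil !addr0 fDl.
- by move=> u v v'; rewrite !big_cons !big_nil !addr0 fDr.
- by move=> c u v; rewrite !big_seq1 fZ.
Qed.

End Tensor.

HB.mixin Record Lmodule_isStarAlgebra (R : realDomainType) A
    of GRing.Lmodule (cplx R) A := {
  amul : A -> A -> A;
  star : A -> A;
  amul_bilinear : linear_in_each *:%R *:%R amul;
  amulA : associative amul;
  star_antilinear : linear_for conj_scale star;
  starM : forall a b, star (amul a b) = amul (star b) (star a);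
  starK : involutive star
}.

#[short(type="starAlgType")]
HB.structure Definition StarAlgebra (R : realDomainType) :=
  {A of Lmodule_isStarAlgebra R A & GRing.Lmodule (cplx R) A}.

Section StarAlgebraTheory.
Variables (R : realDomainType) (A : starAlgType R).

Definition is_unit_elt (e : A) : Prop :=
  forall a, amul e a = a /\ amul a e = a.

Definition idempotent_alg : Prop := spanning (amul : A -> A -> A).

Definition nondegenerate_alg : Prop := forall a : A,
  (forall b, amul a b = 0) \/ (forall b, amul b a = 0) -> a = 0.

Definition positive_functional (w : {scalar A}) : Prop :=
  forall a, cnonneg (w (amul (star a) a)).

Definition positive_elt (a : A) : Prop :=
  forall w : {scalar A}, positive_functional w -> cnonneg (w a).

End StarAlgebraTheory.

(* The library's module structure on matrices concerns coefficients in the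
   ground ring only, hence this alias for M_n(A). *)
Definition mxalg (R : realDomainType) (A : starAlgType R) (n : nat) : Type :=
  'M[A]_n.

Section MatrixStarAlgebra.
Variables (R : realDomainType) (A : starAlgType R) (n : nat).
Implicit Types M N : mxalg A n.

HB.instance Definition _ := GRing.Zmodule.on (mxalg A n).

Definition mx_scale (c : cplx R) M : mxalg A n := \matrix_(i, j) (c *: M i j).

Definition mx_mul M N : mxalg A n :=
  \matrix_(i, j) \sum_k amul (M i k) (N k j).

Definition mx_star M : mxalg A n := \matrix_(i, j) star (M j i).

Fact mx_scaleA c d M : mx_scale c (mx_scale d M) = mx_scale (c * d) M.
Proof. by apply/matrixP => i j; rewrite !mxE scalerA. Qed.

Fact mx_scale1 : left_id 1 mx_scale.
Proof. by move=> M; apply/matrixP => i j; rewrite !mxE scale1r. Qed.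

Fact mx_scaleDr : right_distributive mx_scale +%R.
Proof. by move=> c M N; apply/matrixP => i j; rewrite !mxE scalerDr. Qed.

Fact mx_scaleDl M : {morph mx_scale^~ M : c d / c + d}.
Proof. by move=> c d; apply/matrixP => i j; rewrite !mxE scalerDl. Qed.

HB.instance Definition _ := GRing.Zmodule_isLmodule.Build (cplx R) (mxalg A n)
  mx_scaleA mx_scale1 mx_scaleDr mx_scaleDl.

Fact mx_mul_bilinear : bilinear2 mx_mul.
Proof.
have [lin_l lin_r] := @amul_bilinear R A.
split=> [N c M M' | M c N N']; apply/matrixP => i j; rewrite !mxE scaler_sumr.
  by rewrite -big_split; apply: eq_bigr => k _; rewrite !mxE; apply: lin_l.
by rewrite -big_split; apply: eq_bigr => k _; rewrite !mxE; apply: lin_r.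
Qed.

Let sumL (I : finType) (F : I -> A) b :
  amul (\sum_i F i) b = \sum_i amul (F i) b.
Proof.
have [lin_l _] := @amul_bilinear R A.
have lD a a' : amul (a + a') b = amul a b + amul a' b.
  by rewrite -[a]scale1r lin_l !scale1r.
apply: (big_morph (amul^~ b) lD).
by apply: (addrI (amul 0 b)); rewrite -lD !addr0.
Qed.

Let sumR (I : finType) (F : I -> A) a :
  amul a (\sum_i F i) = \sum_i amul a (F i).
Proof.
have [_ lin_r] := @amul_bilinear R A.
have rD b b' : amul a (b + b') = amul a b + amul a b'.
  by rewrite -[b]scale1r lin_r !scale1r.
apply: (big_morph (amul a) rD).
by apply: (addrI (amul a 0)); rewrite -rD !addr0.
Qed.

Let cconj1 : cconj (1 : cplx R) = 1.
Proof. by congr (Complex _ _); rewrite oppr0. Qed.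

Let starS (I : finType) (F : I -> A) : star (\sum_i F i) = \sum_i star (F i).
Proof.
have sD a b : star (a + b) = star a + star b :> A.
  rewrite -[a]scale1r (star_antilinear (1 : cplx R) a b) /conj_scale cconj1.
  by rewrite !scale1r.
apply: (big_morph _ sD).
by apply: (addrI (star 0)); rewrite -sD !addr0.
Qed.

Fact mx_mulA : associative mx_mul.
Proof.
move=> M N P; apply/matrixP => i j; rewrite !mxE.
under eq_bigr do rewrite mxE sumR.
under [RHS]eq_bigr do rewrite mxE sumL.
rewrite exchange_big; apply: eq_bigr => k _; apply: eq_bigr => l _.
exact: amulA.
Qed.

Fact mx_star_antilinear : linear_for conj_scale mx_star.
Proof.
move=> c M N; apply/matrixP => i j; rewrite !mxE.
exact: star_antilinear.
Qed.

Fact mx_starM M N : mx_star (mx_mul M N) = mx_mul (mx_star N) (mx_star M).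
Proof.
apply/matrixP => i j; rewrite !mxE starS; apply: eq_bigr => k _.
by rewrite !mxE starM.
Qed.

Fact mx_starK : involutive mx_star.
Proof. by move=> M; apply/matrixP => i j; rewrite !mxE starK. Qed.

HB.instance Definition _ := Lmodule_isStarAlgebra.Build R (mxalg A n)
  mx_mul_bilinear mx_mulA mx_star_antilinear mx_starM mx_starK.

End MatrixStarAlgebra.

HB.mixin Record Algebra_isHopfStar (R : realDomainType) H
    of GRing.Algebra (cplx R) H := {
  hstar : H -> H;
  comul : H -> tensor H H;
  counit : H -> cplx R;
  antipode : H -> H;
  hstar_antilinear : linear_for conj_scale hstar;
  hstarM : forall g h, hstar (g * h) = hstar h * hstar g;
  hstarK : involutive hstar;
  comul_linear : linear comul;
  counit_linear : linear_for *%R counit;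
  comulA : forall g,
    sweedler (fun g1 g2 => sweedler (fun h1 h2 => tens h1 (tens h2 g2))
      (comul g1)) (comul g) =
    sweedler (fun g1 g2 => sweedler (fun h1 h2 => tens g1 (tens h1 h2))
      (comul g2)) (comul g);
  counitl : forall g,
    sweedler (fun g1 g2 => counit g1 *: g2) (comul g) = g;
  counitr : forall g,
    sweedler (fun g1 g2 => counit g2 *: g1) (comul g) = g;
  comul1 : comul 1 = tens 1 1;
  comulM : forall g h, comul (g * h) =
    sweedler (fun g1 g2 => sweedler (fun h1 h2 => tens (g1 * h1) (g2 * h2))
      (comul h)) (comul g);
  comul_star : forall g, comul (hstar g) =
    sweedler (fun g1 g2 => tens (hstar g1) (hstar g2)) (comul g);
  counit1 : counit 1 = 1;
  counitM : forall g h, counit (g * h) = counit g * counit h;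
  counit_star : forall g, counit (hstar g) = cconj (counit g);
  antipode_linear : linear antipode;
  antipodel : forall g,
    sweedler (fun g1 g2 => antipode g1 * g2) (comul g) = (counit g)%:A;
  antipoder : forall g,
    sweedler (fun g1 g2 => g1 * antipode g2) (comul g) = (counit g)%:A;
  antipode_star : forall g, hstar (antipode (hstar (antipode g))) = g
}.

#[short(type="hopfStarAlgType")]
HB.structure Definition HopfStarAlgebra (R : realDomainType) :=
  {H of Algebra_isHopfStar R H & GRing.Algebra (cplx R) H}.

HB.mixin Record StarAlgebra_hasHopfAction (R : realDomainType)
    (H : hopfStarAlgType R) A of StarAlgebra R A := {
  act : H -> A -> A;
  act_bilinear : linear_in_each *:%R *:%R act;
  act1 : forall a, act 1 a = a;
  actA : forall g h a, act (g * h) a = act g (act h a);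
  actM : forall g a b, act g (amul a b) =
    sweedler (fun g1 g2 => amul (act g1 a) (act g2 b)) (comul g);
  act_star : forall g a, star (act g a) = act (hstar (antipode g)) (star a);
  act_unit : forall e : A, is_unit_elt e -> forall g, act g e = counit g *: e
}.

#[short(type="hopfModStarAlgType")]
HB.structure Definition HopfModStarAlgebra (R : realDomainType)
    (H : hopfStarAlgType R) :=
  {A of StarAlgebra_hasHopfAction R H A & StarAlgebra R A}.

Record idemNondegAlg (R : realDomainType) (H : hopfStarAlgType R) : Type :=
  IdemNondegAlg {
    ina_alg :> hopfModStarAlgType H;
    ina_idempotent : idempotent_alg ina_alg;
    ina_nondegenerate : nondegenerate_alg ina_alg
  }.

Section ModulesAndInnerProducts.
Variables (R : realDomainType) (A : starAlgType R) (E : lmodType (cplx R)).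

Record left_module (l : A -> E -> E) : Prop := {
  lmodule_bilinear : bilinear2 l;
  lmoduleA : forall a b x, l (amul a b) x = l a (l b x);
  lmodule_unit : forall e : A, is_unit_elt e -> forall x, l e x = x
}.

Record right_module (r : E -> A -> E) : Prop := {
  rmodule_bilinear : bilinear2 r;
  rmoduleA : forall x a b, r x (amul a b) = r (r x a) b;
  rmodule_unit : forall e : A, is_unit_elt e -> forall x, r x e = x
}.

Record left_inner_product (l : A -> E -> E) (ip : E -> E -> A) : Prop := {
  lip_sesquilinear : linear_in_each *:%R conj_scale ip;
  lip_linear : forall a x y, ip (l a x) y = amul a (ip x y);
  lip_herm : forall x y, ip x y = star (ip y x)
}.

Record right_inner_product (r : E -> A -> E) (ip : E -> E -> A) : Prop := {
  rip_sesquilinear : linear_in_each conj_scale *:%R ip;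
  rip_linear : forall x y a, ip x (r y a) = amul (ip x y) a;
  rip_herm : forall x y, ip x y = star (ip y x)
}.

Definition nondegenerate_ip (ip : E -> E -> A) : Prop :=
  forall x, (forall y, ip x y = 0) -> x = 0.

Definition full_ip (ip : E -> E -> A) : Prop := spanning ip.

Definition completely_positive (ip : E -> E -> A) : Prop :=
  forall (n : nat) (x : 'I_n -> E),
    positive_elt (\matrix_(i, j) ip (x i) (x j) : mxalg A n).

End ModulesAndInnerProducts.

Record hopf_module (R : realDomainType) (H : hopfStarAlgType R)
    (E : lmodType (cplx R)) (h : H -> E -> E) : Prop := {
  hmodule_bilinear : bilinear2 h;
  hmodule1 : forall x, h 1 x = x;
  hmoduleA : forall g g' x, h (g * g') x = h g (h g' x)
}.

Record starEquivBimod (R : realDomainType) (H : hopfStarAlgType R)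
    (B A : hopfModStarAlgType H) : Type := StarEquivBimod {
  bim_sort :> lmodType (cplx R);
  lmul : B -> bim_sort -> bim_sort;
  rmul : bim_sort -> A -> bim_sort;
  lip : bim_sort -> bim_sort -> B;
  rip : bim_sort -> bim_sort -> A;
  hact : H -> bim_sort -> bim_sort;
  bim_lmodule : left_module lmul;
  bim_rmodule : right_module rmul;
  bim_assoc : forall b x a, rmul (lmul b x) a = lmul b (rmul x a);
  bim_lspan : spanning lmul;
  bim_rspan : spanning rmul;
  bim_lip : left_inner_product lmul lip;
  bim_rip : right_inner_product rmul rip;
  bim_lip_nondeg : nondegenerate_ip lip;
  bim_rip_nondeg : nondegenerate_ip rip;
  bim_lip_full : full_ip lip;
  bim_rip_full : full_ip rip;
  bim_rip_lmul : forall b x y, rip (lmul b x) y = rip x (lmul (star b) y);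
  bim_lip_rmul : forall x a y, lip (rmul x a) y = lip x (rmul y (star a));
  bim_lip_rip : forall x y z, lmul (lip x y) z = rmul x (rip y z);
  bim_hmodule : hopf_module hact;
  bim_act_rip : forall g x y, act g (rip x y) =
    sweedler (fun g1 g2 => rip (hact (hstar (antipode g1)) x) (hact g2 y))
      (comul g);
  bim_act_lip : forall g x y, act g (lip x y) =
    sweedler (fun g1 g2 => lip (hact g1 x) (hact (hstar (antipode g2)) y))
      (comul g)
}.

Arguments lip {R H B A} E : rename.
Arguments rip {R H B A} E : rename.

Section MoritaEquivalence.
Variables (R : realDomainType) (H : hopfStarAlgType R).
Implicit Types A B : hopfModStarAlgType H.

Definition strong_bimod A B (E : starEquivBimod B A) : Prop :=
  completely_positive (lip E) /\ completely_positive (rip E).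

Definition star_Morita_equivalent A B : Prop := inhabited (starEquivBimod B A).

Definition strongly_Morita_equivalent A B : Prop :=
  exists E : starEquivBimod B A, strong_bimod E.

Record equivariant_star_iso A B (Phi : {linear A -> B}) : Prop := {
  iso_bijective : bijective Phi;
  iso_mul : {morph Phi : a b / amul a b};
  iso_star : {morph Phi : a / star a};
  iso_act : forall g a, Phi (act g a) = act g (Phi a)
}.

Definition equivariantly_star_isomorphic A B : Prop :=
  exists Phi : {linear A -> B}, equivariant_star_iso Phi.

End MoritaEquivalence.

(* Main.v *)
(* A Morita bimodule E for (B, A) is tensored with one for (D, B) by taking
   F (x) E over C, with <y (x) x, y' (x) x'> = <x, <y, y'> x'>,
   and dividing by the degeneracy space of the A-valued inner product; this
   makes the product B-balanced, and the D-valued inner product degenerates on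
   the same space.  Compatibility of H with the inner products is handled
   through g |> <x, y> = <S(g1)^* x, g2 y> being equivalent to the antipode-free
   <x, g y> = g2 |> <g1^* x, y>, which passes to tensor products.  This identity
   also gives g (x a) = (g1 x) (g2 a) by nondegeneracy, whence
   g (b x) = (g1 b) (g2 x) by fullness; conversely these two imply the
   compatibility for the left inner product, because B acts faithfully.
   Symmetry uses the conjugate bimodule with g acting as S(g)^*, and an
   isomorphism A -> B turns A itself into an equivalence bimodule. *)
From HB Require Import structures.
Require Import Defs.
From Stdlib Require Import RelationClasses.
From mathcomp Require Import all_boot all_order all_algebra.
From mathcomp Require Import generic_quotient boolp.
From mathcomp Require Import complex.

Set Implicit Arguments.
Unset Strict Implicit.
Unset Printing Implicit Defensive.

Import Order.TTheory GRing.Theory Num.Theory.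
Local Open Scope ring_scope.
Local Open Scope quotient_scope.

(** * Sweedler sums and linear maps *)

(** Three obstacles shape the proof. Before reduction neither inner product need be nondegenerate,
    and the exchange law <x, y> z = x <y, z> holds only modulo degenerate elements. Hence everything
    shared by the reduced and the unreduced situation is proved for a weaker structure, and
    nondegeneracy of the left inner product, covariance of the right multiplication and covariance
    of the left inner product are derived on the quotient. Every operation descends for one reason:
    its pairing against any element depends only on pairings of its argument. A positive element is
    defined by testing against functionals and is not given as a sum of squares, so complete
    positivity of a composite cannot come from factoring a Gram matrix. Instead, positive
    functionals are pulled back. Sesquilinear maps are treated as bilinear maps with values in, or
    defined on, a conjugate module, which lets one set of lemmas on tensors and spans serve both
    inner products. *)

Section LinearFor.
Variables (C : comNzRingType) (U V : lmodType C).

Lemma linear_forD (f : U -> V) : linear f -> {morph f : x y / x + y}.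
Proof. by move=> lf x y; rewrite -[x]scale1r lf !scale1r. Qed.

Lemma linear_for0 (f : U -> V) : linear f -> f 0 = 0.
Proof. by move=> lf; apply: (addrI (f 0)); rewrite -linear_forD ?addr0. Qed.

Lemma linear_forZ (f : U -> V) : linear f -> forall c x, f (c *: x) = c *: f x.
Proof. by move=> lf c x; rewrite -[_ *: x]addr0 lf linear_for0 ?addr0. Qed.

Lemma linear_forB (f : U -> V) : linear f -> {morph f : x y / x - y}.
Proof.
by move=> lf x y; rewrite -scaleN1r linear_forD // linear_forZ // scaleN1r.
Qed.

Lemma linear_for_sum (f : U -> V) : linear f ->
  forall (I : Type) (r : seq I) (P : pred I) (F : I -> U),
  f (\sum_(i <- r | P i) F i) = \sum_(i <- r | P i) f (F i).
Proof.
move=> lf I r P F; apply: big_morph; [exact: linear_forD | exact: linear_for0].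
Qed.

End LinearFor.

Section Spanned.
Variables (C : comNzRingType) (X Y : Type) (W : lmodType C) (f : X -> Y -> W).

(** [spanning f] is convertible to [forall w, spanned w]; the pointwise form makes membership in a
    span a predicate to which [spanning_ind] applies. *)
Definition spanned (w : W) : Prop := exists s : seq (C * (X * Y)),
  w = \sum_(p <- s) p.1 *: f p.2.1 p.2.2.

Lemma spanned_gen x y : spanned (f x y).
Proof. by exists [:: (1, (x, y))]; rewrite big_seq1 scale1r. Qed.

Lemma spanned_lin c w w' : spanned w -> spanned w' -> spanned (c *: w + w').
Proof.
move=> [s ->] [s' ->]; exists ([seq (c * p.1, p.2) | p <- s] ++ s').
rewrite big_cat big_map scaler_sumr; congr (_ + _).
by apply: eq_bigr => p _; rewrite scalerA.
Qed.

Lemma spanned0 : spanned 0.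
Proof. by exists [::]; rewrite big_nil. Qed.

Lemma spanning_ind (P : W -> Prop) : spanning f -> P 0 ->
    (forall c w w', P w -> P w' -> P (c *: w + w')) ->
    (forall x y, P (f x y)) ->
  forall w, P w.
Proof.
move=> fS P0 PD Pf w; have [s ->] := fS w.
by elim/big_rec: _ => // p v _; apply: PD.
Qed.

End Spanned.

(** This chains spanning conditions: the arguments of an expression are replaced one after another
    by generators, while the closure properties of [P] are proved once, in the target. *)
Lemma spanned_linear (C : comNzRingType) (X Y : Type) (V W : lmodType C)
    (g : X -> Y -> V) (P : W -> Prop) (L : V -> W) :
  linear L -> P 0 -> (forall c w w', P w -> P w' -> P (c *: w + w')) ->
  spanning g -> (forall x y, P (L (g x y))) -> forall v, P (L v).
Proof.
move=> lL P0 PD gS Pg; apply: (spanning_ind gS) => //.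
  by rewrite linear_for0.
by move=> c w w' Pw Pw'; rewrite lL; apply: PD.
Qed.

Lemma spanning_surj (C : comNzRingType) (X Y X' Y' : Type) (V W : lmodType C)
    (L : V -> W) (f : X -> Y -> V) (f' : X' -> Y' -> W) :
  linear L -> (forall w, exists v, L v = w) ->
  (forall x y, exists x' y', L (f x y) = f' x' y') ->
  spanning f -> spanning f'.
Proof.
move=> lL Ls ff' fS w; have [v <-] := Ls w.
apply: (spanned_linear (P := spanned f') lL _ _ fS).
- exact: (spanned0 f').
- exact: (@spanned_lin _ _ _ _ f').
- by move=> x y; have [x' [y' ->]] := ff' x y; exact: (spanned_gen f').
Qed.

Lemma tens_pi (C : comNzRingType) (U V : lmodType C) (s : seq (U * V)) :
  \pi_(tensor U V) s = \sum_(p <- s) tens p.1 p.2.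
Proof.
elim: s => [|[u v] s IHs]; first by rewrite big_nil.
rewrite big_cons -IHs /GRing.add /= /tens_add; apply/tens_piP/tens_sym.
by rewrite -(cat1s (u, v)); apply: tens_cat; apply: tens_repr.
Qed.

Section SweedlerTheory.
Variables (C : comNzRingType) (U V : lmodType C).

Lemma eq_sweedler (W : zmodType) (f f' : U -> V -> W) x :
  (forall u v, f u v = f' u v) -> sweedler f x = sweedler f' x.
Proof. by move=> ff'; apply: eq_bigr. Qed.

Lemma linear_sweedler_out (W W' : lmodType C) (L : W -> W')
    (f : U -> V -> W) x :
  linear L -> L (sweedler f x) = sweedler (fun u v => L (f u v)) x.
Proof. by move=> lL; apply: linear_for_sum. Qed.

Lemma sweedler_linear_fun (W : lmodType C) (f f' : U -> V -> W) c x :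
  sweedler (fun u v => c *: f u v + f' u v) x =
  c *: sweedler f x + sweedler f' x.
Proof. by rewrite /sweedler big_split -scaler_sumr. Qed.

Lemma exchange_sweedler (U' V' : lmodType C) (W : zmodType)
    (f : U -> V -> U' -> V' -> W) x y :
  sweedler (fun u v => sweedler (f u v) y) x =
  sweedler (fun u' v' => sweedler (fun u v => f u v u' v') x) y.
Proof. exact: exchange_big. Qed.

Variables (W : lmodType C) (f : U -> V -> W).
Hypothesis lf : bilinear2 f.

Lemma sweedler_pi s : sweedler f (\pi_(tensor U V) s) = \sum_(p <- s) f p.1 p.2.
Proof.
case: lf => l r; apply: sweedlerE => [u u' v | u v v' | c u v].
- exact: (linear_forD (l v)).
- exact: (linear_forD (r u)).
- by rewrite (linear_forZ (l v)) (linear_forZ (r u)).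
Qed.

Lemma sweedler_tens u v : sweedler f (tens u v) = f u v.
Proof. by rewrite sweedler_pi big_seq1. Qed.

Lemma linear_sweedler : linear (sweedler f).
Proof.
move=> c x y; rewrite -{1}[x]reprK -{1}[y]reprK !tens_pi.
(* [sweedler] reads chosen representatives, which are not additive; the list [s] presents c x + y
   explicitly, and [sweedler_pi] allows evaluation on it. *)
pose s := [seq (c *: p.1, p.2) | p : U * V <- repr x] ++ repr y.
have -> : c *: (\sum_(p <- repr x) tens p.1 p.2) +
    \sum_(p <- repr y) tens p.1 p.2 = \pi_(tensor U V) s.
  rewrite tens_pi big_cat big_map /= scaler_sumr; congr (_ + _).
  apply: eq_bigr => p _; case: (@tens_bilinear C U V) => l r.
  by rewrite (linear_forZ (l _)).
rewrite sweedler_pi big_cat big_map /= /sweedler scaler_sumr; congr (_ + _).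
by apply: eq_bigr => p _; case: lf => l r; rewrite (linear_forZ (l _)).
Qed.

End SweedlerTheory.

Lemma tensor_ind (C : comNzRingType) (U V : lmodType C)
    (P : tensor U V -> Prop) :
    (forall c x y, P x -> P y -> P (c *: x + y)) ->
    (forall u v, P (tens u v)) ->
  forall x, P x.
Proof.
move=> PD Pt x; rewrite -[x]reprK tens_pi; elim/big_rec: _ => [|p v _ Pv].
  (* Zero is reached as the combination -1 t + t of the pure tensor t = 0 ⊗ 0. *)
  by rewrite -(addNr (tens 0 0)) -scaleN1r; apply: PD.
by rewrite -[tens _ _]scale1r; apply: PD.
Qed.

(** * Conjugation and Hopf *-algebras *)

Section Conjugation.
Variable R : realDomainType.
Implicit Types c d : cplx R.

Lemma cconjK : involutive (@cconj R).
Proof. by case=> a b; rewrite /cconj /= opprK. Qed.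

Lemma cconj1 : cconj (1 : cplx R) = 1.
Proof. by congr (Complex _ _); rewrite oppr0. Qed.

Lemma cconjD c d : cconj (c + d) = cconj c + cconj d.
Proof. by case: c d => a b [a' b']; congr (Complex _ _); rewrite opprD. Qed.

Lemma cconjM c d : cconj (c * d) = cconj c * cconj d.
Proof.
case: c d => a b [a' b']; congr (Complex _ _) => /=.
  by rewrite mulrNN.
by rewrite opprD mulrN mulNr.
Qed.

Lemma cnonneg0 : cnonneg (0 : cplx R).
Proof. by rewrite /cnonneg /= eqxx lexx. Qed.

Lemma cnonnegD c d : cnonneg c -> cnonneg d -> cnonneg (c + d).
Proof.
case: c d => a b [a' b'] /andP[/eqP /= -> a0] /andP[/eqP /= -> a'0].
by rewrite /cnonneg /= addr0 eqxx addr_ge0.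
Qed.

(** The conjugate module: an antilinear map into [V] is a linear map into [conjmod V]. As the
    additive group is unchanged, sums and [sweedler] have the same value in both. *)
Definition conjmod (V : lmodType (cplx R)) : Type := V.

Section ConjModule.
Variable V : lmodType (cplx R).

HB.instance Definition _ := GRing.Zmodule.on (conjmod V).

Fact conj_scaleA c d (v : conjmod V) :
  conj_scale c (conj_scale d v : V) = conj_scale (c * d) v.
Proof. by rewrite /conj_scale scalerA cconjM. Qed.

Fact conj_scale1 : left_id 1 (@conj_scale R V).
Proof. by move=> v; rewrite /conj_scale cconj1 scale1r. Qed.

Fact conj_scaleDr : right_distributive (@conj_scale R V) +%R.
Proof. by move=> c u v; rewrite /conj_scale scalerDr. Qed.

Fact conj_scaleDl v : {morph (@conj_scale R V)^~ v : c d / c + d}.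
Proof. by move=> c d; rewrite /conj_scale cconjD scalerDl. Qed.

HB.instance Definition _ := GRing.Zmodule_isLmodule.Build (cplx R) (conjmod V)
  conj_scaleA conj_scale1 conj_scaleDr conj_scaleDl.

End ConjModule.

Lemma conjmod_scaleE (V : lmodType (cplx R)) c (v : V) :
  c *: (v : conjmod V) = cconj c *: v.
Proof. by []. Qed.

End Conjugation.

Section StarAlgebraRules.
Variables (R : realDomainType) (A : starAlgType R).
Implicit Types (c : cplx R) (a b : A).

Lemma amulPl c a a' b : amul (c *: a + a') b = c *: amul a b + amul a' b.
Proof. by case: (@amul_bilinear R A) => l _; apply: l. Qed.

Lemma amulPr c a b b' : amul a (c *: b + b') = c *: amul a b + amul a b'.
Proof. by case: (@amul_bilinear R A) => _ r; apply: r. Qed.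

Lemma amul_linl b : linear (amul^~ b : A -> A).
Proof. by move=> c x y; rewrite amulPl. Qed.

Lemma amul_linr a : linear (amul a : A -> A).
Proof. by move=> c x y; rewrite amulPr. Qed.

Lemma starP c a b : star (c *: a + b) = cconj c *: star a + star b :> A.
Proof. exact: star_antilinear. Qed.

Lemma star0 : star 0 = 0 :> A.
Proof. exact: (linear_for0 (V := conjmod A) starP). Qed.

Lemma star_inj : injective (star : A -> A).
Proof. exact: can_inj starK. Qed.

Lemma star_unit (e : A) : is_unit_elt e -> star e = e.
Proof.
move=> ue; have := congr1 star (ue (star e)).1.
by rewrite starM !starK (ue _).1.
Qed.

End StarAlgebraRules.

Section HopfRules.
Variables (R : realDomainType) (H : hopfStarAlgType R).
Implicit Types (c : cplx R) (g h : H).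

Lemma hmulPl c g g' h : (c *: g + g') * h = c *: (g * h) + g' * h.
Proof. by rewrite mulrDl scalerAl. Qed.

Lemma hmulPr c g h h' : g * (c *: h + h') = c *: (g * h) + g * h'.
Proof. by rewrite mulrDr scalerAr. Qed.

Lemma hstarP c g h : hstar (c *: g + h) = cconj c *: hstar g + hstar h :> H.
Proof. exact: hstar_antilinear. Qed.

Lemma antipodeP c g h :
  antipode (c *: g + h) = c *: antipode g + antipode h :> H.
Proof. exact: antipode_linear. Qed.

Lemma counitP c (g h : H) : counit (c *: g + h) = c * counit g + counit h.
Proof. exact: counit_linear. Qed.

Lemma comulP c (g h : H) : comul (c *: g + h) = c *: comul g + comul h.
Proof. exact: comul_linear. Qed.

Lemma hstar1 : hstar 1 = 1 :> H.
Proof. by rewrite -[LHS]mul1r -{1}[1]hstarK -hstarM mul1r hstarK. Qed.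

Lemma antipode1 : antipode 1 = 1 :> H.
Proof.
have := antipodel (1 : H); rewrite comul1 counit1 scale1r sweedler_tens ?mulr1 //.
by split=> [h | g] c u v; rewrite ?antipodeP ?hmulPl ?hmulPr.
Qed.

Lemma counitZP (V : lmodType (cplx R)) c g h (v : V) :
  counit (c *: g + h) *: v = c *: (counit g *: v) + counit h *: v.
Proof. by rewrite counitP scalerDl scalerA. Qed.

Lemma scaleP (V : lmodType (cplx R)) d c (v v' : V) :
  d *: (c *: v + v') = c *: (d *: v) + d *: v'.
Proof. by rewrite scalerDr !scalerA mulrC. Qed.

Definition trilinear (U V W X : lmodType (cplx R))
    (f : U -> V -> W -> X) : Prop :=
  [/\ forall v w, linear (fun u => f u v w),
      forall u w, linear (fun v => f u v w)
    & forall u v, linear (fun w => f u v w)].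

(** The axiom [comulA] is an equality in H ⊗ (H ⊗ H). A trilinear [f] induces a linear map [F] on
    that space, and applying [F] to both sides gives the rule for renumbering Sweedler legs. *)
Lemma sweedlerA (X : lmodType (cplx R)) (f : H -> H -> H -> X) g :
    trilinear f ->
  sweedler (fun g1 g2 => sweedler (fun h1 h2 => f h1 h2 g2) (comul g1))
    (comul g) =
  sweedler (fun g1 g2 => sweedler (fun h1 h2 => f g1 h1 h2) (comul g2))
    (comul g).
Proof.
move=> [l1 l2 l3].
have bl2 a : bilinear2 (f a) by split=> *; [apply: l2 | apply: l3].
pose F (t : tensor H (tensor H H)) := sweedler (fun a => sweedler (f a)) t.
have blF : bilinear2 (fun a => sweedler (f a)).
  split=> [t c u v | a]; last exact: linear_sweedler.
  rewrite -sweedler_linear_fun; apply: eq_sweedler => x y; exact: l1.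
have FE x y z : F (tens x (tens y z)) = f x y z.
  by rewrite /F !sweedler_tens.
have lF : linear F by apply: linear_sweedler.
have := congr1 F (comulA g); rewrite !(linear_sweedler_out _ _ lF).
under eq_sweedler do rewrite (linear_sweedler_out _ _ lF).
under [RHS]eq_sweedler do rewrite (linear_sweedler_out _ _ lF).
under eq_sweedler => g1 g2 do under eq_sweedler => h1 h2 do rewrite FE.
under [RHS]eq_sweedler => g1 g2 do under eq_sweedler => h1 h2 do rewrite FE.
by [].
Qed.

Lemma comul_bilinear (X : lmodType (cplx R)) (f : H -> H -> X) :
  bilinear2 f -> linear (fun g : H => sweedler f (comul g)).
Proof. by move=> lf c g h; rewrite comulP (linear_sweedler lf). Qed.

Lemma sweedler_comulM (X : lmodType (cplx R)) (f : H -> H -> X) g h :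
    bilinear2 f ->
  sweedler f (comul (g * h)) =
  sweedler (fun g1 g2 => sweedler (fun h1 h2 => f (g1 * h1) (g2 * h2))
    (comul h)) (comul g).
Proof.
move=> lf; rewrite comulM (linear_sweedler_out _ _ (linear_sweedler lf)).
apply: eq_sweedler => g1 g2.
rewrite (linear_sweedler_out _ _ (linear_sweedler lf)).
by apply: eq_sweedler => h1 h2; rewrite sweedler_tens.
Qed.

Lemma sweedler_comul_star (X : lmodType (cplx R)) (f : H -> H -> X) g :
    bilinear2 f ->
  sweedler f (comul (hstar g)) =
  sweedler (fun g1 g2 => f (hstar g1) (hstar g2)) (comul g).
Proof.
move=> lf; rewrite comul_star (linear_sweedler_out _ _ (linear_sweedler lf)).
by apply: eq_sweedler => g1 g2; rewrite sweedler_tens.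
Qed.

(** Mostly read from right to left: a term in g receives a second leg weighted by the counit, so
    that it can be compared leg by leg with a sum in which an antipode collapses. *)
Lemma sweedler_counitl (X : lmodType (cplx R)) (L : H -> X) g :
  linear L -> sweedler (fun g1 g2 => counit g1 *: L g2) (comul g) = L g.
Proof.
move=> lL; rewrite -[in RHS](counitl g) (linear_sweedler_out _ _ lL).
by apply: eq_sweedler => g1 g2; rewrite linear_forZ.
Qed.

Lemma sweedler_counitr (X : lmodType (cplx R)) (L : H -> X) g :
  linear L -> sweedler (fun g1 g2 => counit g2 *: L g1) (comul g) = L g.
Proof.
move=> lL; rewrite -[in RHS](counitr g) (linear_sweedler_out _ _ lL).
by apply: eq_sweedler => g1 g2; rewrite linear_forZ.
Qed.

Lemma sweedler_antipodel (X : lmodType (cplx R)) (L : H -> X) g : linear L ->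
  sweedler (fun g1 g2 => L (antipode g1 * g2)) (comul g) = counit g *: L 1.
Proof.
by move=> lL; rewrite -linear_sweedler_out // antipodel linear_forZ.
Qed.

Lemma sweedler_antipoder (X : lmodType (cplx R)) (L : H -> X) g : linear L ->
  sweedler (fun g1 g2 => L (g1 * antipode g2)) (comul g) = counit g *: L 1.
Proof.
by move=> lL; rewrite -linear_sweedler_out // antipoder linear_forZ.
Qed.

End HopfRules.

(** Multilinearity of a nested expression is settled by pushing a combination c x + y outwards
    through every map; [cconjK] cancels the conjugations of two nested antilinear maps, as in <g^*
    x, y>. *)
Ltac lin_rules := rewrite ?amulPl ?amulPr ?starP ?hmulPl ?hmulPr ?hstarP
  ?antipodeP ?counitZP ?scaleP ?cconjK.
Ltac lin := do ?[split | move=> ?]; repeat (progress lin_rules); reflexivity.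

Section AntipodeM.
Variables (R : realDomainType) (H : hopfStarAlgType R).
Implicit Types g h : H.

Lemma comul_linear_arg (U X : lmodType (cplx R)) (f : U -> H -> H -> X) g :
  (forall a b, linear (fun u => f u a b)) ->
  linear (fun u => sweedler (f u) (comul g)).
Proof.
move=> lf c u v; rewrite -sweedler_linear_fun; apply: eq_sweedler => a b.
exact: lf.
Qed.

(* Uniqueness of convolution inverses: both [antipode (g * h)] and
   [antipode h * antipode g] invert [g * h]. *)
Lemma antipodeM g h : antipode (g * h) = antipode h * antipode g.
Proof.
(* The convolution product of k l with S(l) S(k). Collapsing first the legs of l, then those of k,
   gives the counits. *)
pose T (k l : H) := sweedler (fun k1 k2 => sweedler (fun l1 l2 =>
  k1 * l1 * (antipode l2 * antipode k2)) (comul l)) (comul k).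
have TE k l : T k l = (counit k * counit l)%:A.
  rewrite -scalerA; rewrite -[X in counit k *: X]/((fun x => counit l *: x) 1).
  rewrite -(@sweedler_antipoder _ _ _ _ k); last by lin.
  apply: eq_sweedler => k1 k2.
  transitivity (sweedler (fun l1 l2 => k1 * (l1 * antipode l2) * antipode k2)
    (comul l)).
    by apply: eq_sweedler => l1 l2; rewrite !mulrA.
  rewrite (@sweedler_antipoder _ _ _ (fun x => k1 * x * antipode k2)); last by lin.
  by rewrite mulr1.
(* The triple convolution of S(g h), g h and S(h) S(g), bracketed so that the last two factors
   collapse. *)
have lhs : sweedler (fun g1 g2 => sweedler (fun h1 h2 =>
    antipode (g1 * h1) * T g2 h2) (comul h)) (comul g) = antipode (g * h).
  rewrite -[RHS](@sweedler_counitr _ _ _ (fun x => antipode (x * h))); last by lin.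
  apply: eq_sweedler => g1 g2.
  rewrite -(@sweedler_counitr _ _ _ (fun x => counit g2 *: antipode (g1 * x)) h);
    last by lin.
  apply: eq_sweedler => h1 h2.
  by rewrite TE -scalerAr mulr1 mulrC scalerA.
rewrite -lhs.
transitivity (sweedler (fun g1 g2 => sweedler (fun g21 g22 =>
    sweedler (fun h1 h2 => sweedler (fun h21 h22 =>
      antipode (g1 * h1) * (g21 * h21 * (antipode h22 * antipode g22))) (comul h2))
      (comul h)) (comul g2)) (comul g)).
  apply: eq_sweedler => g1 g2; rewrite exchange_sweedler.
  apply: eq_sweedler => h1 h2.
  rewrite (linear_sweedler_out (L := *%R (antipode (g1 * h1)))); last by lin.
  apply: eq_sweedler => g21 g22.
  by rewrite (linear_sweedler_out (L := *%R (antipode (g1 * h1)))); last by lin.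
transitivity (sweedler (fun g1 g2 => sweedler (fun g21 g22 =>
    sweedler (fun h1 h2 => sweedler (fun h11 h12 =>
      antipode (g1 * h11) * (g21 * h12 * (antipode h2 * antipode g22))) (comul h1))
      (comul h)) (comul g2)) (comul g)).
  apply: eq_sweedler => g1 g2; apply: eq_sweedler => g21 g22.
  rewrite (@sweedlerA _ _ _ (fun a b c =>
    antipode (g1 * a) * (g21 * b * (antipode c * antipode g22)))) //; lin.
(* After reassociating in h and now in g, the first two factors read S(x1) x2 over the coproduct of
   x = g1 h1; they collapse and leave S(h) S(g). *)
rewrite -(@sweedlerA _ _ _ (fun a b c =>
    sweedler (fun h1 h2 => sweedler (fun h11 h12 =>
      antipode (a * h11) * (b * h12 * (antipode h2 * antipode c))) (comul h1))
      (comul h))).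
  rewrite -[RHS](@sweedler_counitl _ _ _ (fun x => antipode h * antipode x));
    last by lin.
  apply: eq_sweedler => g1 g2; rewrite exchange_sweedler.
  rewrite -[RHS](@sweedler_counitl _ _ _ (fun x =>
    counit g1 *: (antipode x * antipode g2))); last by lin.
  apply: eq_sweedler => h1 h2.
  transitivity (sweedler (fun x1 x2 =>
    antipode x1 * x2 * (antipode h2 * antipode g2)) (comul (g1 * h1))).
    rewrite sweedler_comulM; last by lin.
    apply: eq_sweedler => a b; apply: eq_sweedler => c d.
    by rewrite !mulrA.
  rewrite (@sweedler_antipodel _ _ _ (fun x => x * (antipode h2 * antipode g2)));
    last by lin.
  by rewrite mul1r counitM scalerA mulrC.
by split=> *; do 2![apply: comul_linear_arg => * ]; lin.
Qed.

End AntipodeM.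

(** * Covariance conditions *)

Section ActionRules.
Variables (R : realDomainType) (H : hopfStarAlgType R).
Variable A : hopfModStarAlgType H.

Lemma actPl (c : cplx R) (g g' : H) (a : A) :
  act (c *: g + g') a = c *: act g a + act g' a.
Proof. by case: (@act_bilinear R H A) => l _; apply: l. Qed.

Lemma actPr (c : cplx R) (g : H) (a a' : A) :
  act g (c *: a + a') = c *: act g a + act g a'.
Proof. by case: (@act_bilinear R H A) => _ r; apply: r. Qed.

Lemma act_linr (g : H) : linear (act g : A -> A).
Proof. by move=> c a a'; rewrite actPr. Qed.

End ActionRules.

Section Prebimodule.
Variables (R : realDomainType) (H : hopfStarAlgType R).
Variables (B A : hopfModStarAlgType H) (E : lmodType (cplx R)).
Variables (l : B -> E -> E) (r : E -> A -> E).
Variables (li : E -> E -> B) (ri : E -> E -> A) (h : H -> E -> E).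

(** Axioms common to equivalence bimodules and unreduced tensor products over C. Nondegeneracy and
    the exchange law [bim_lip_rip] are left out because a tensor product acquires them in general
    only by reduction; covariance is kept separate, as its several forms are to be compared. *)
Record prebimodule : Prop := {
  pre_lmodule : left_module l;
  pre_rmodule : right_module r;
  pre_assoc : forall b x a, r (l b x) a = l b (r x a);
  pre_lip : left_inner_product l li;
  pre_rip : right_inner_product r ri;
  pre_lip_full : full_ip li;
  pre_rip_full : full_ip ri;
  pre_rip_lmul : forall b x y, ri (l b x) y = ri x (l (star b) y);
  pre_lip_rmul : forall x a y, li (r x a) y = li x (r y (star a));
  pre_hmodule : hopf_module h
}.

Hypothesis bE : prebimodule.
Implicit Types (c : cplx R) (x y z : E) (a : A) (b : B) (g : H).

Lemma lmulPl c b b' x : l (c *: b + b') x = c *: l b x + l b' x.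
Proof. by case: (lmodule_bilinear (pre_lmodule bE)) => p _; apply: p. Qed.

Lemma lmulPr c b x x' : l b (c *: x + x') = c *: l b x + l b x'.
Proof. by case: (lmodule_bilinear (pre_lmodule bE)) => _ p; apply: p. Qed.

Lemma rmulPl c x x' a : r (c *: x + x') a = c *: r x a + r x' a.
Proof. by case: (rmodule_bilinear (pre_rmodule bE)) => p _; apply: p. Qed.

Lemma rmulPr c x a a' : r x (c *: a + a') = c *: r x a + r x a'.
Proof. by case: (rmodule_bilinear (pre_rmodule bE)) => _ p; apply: p. Qed.

Lemma lipPl c x x' y : li (c *: x + x') y = c *: li x y + li x' y.
Proof. by case: (lip_sesquilinear (pre_lip bE)) => p _; apply: p. Qed.

Lemma lipPr c x y y' : li x (c *: y + y') = cconj c *: li x y + li x y'.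
Proof. by case: (lip_sesquilinear (pre_lip bE)) => _ p; apply: p. Qed.

Lemma ripPl c x x' y : ri (c *: x + x') y = cconj c *: ri x y + ri x' y.
Proof. by case: (rip_sesquilinear (pre_rip bE)) => p _; apply: p. Qed.

Lemma ripPr c x y y' : ri x (c *: y + y') = c *: ri x y + ri x y'.
Proof. by case: (rip_sesquilinear (pre_rip bE)) => _ p; apply: p. Qed.

Lemma hactPl c g g' x : h (c *: g + g') x = c *: h g x + h g' x.
Proof. by case: (hmodule_bilinear (pre_hmodule bE)) => p _; apply: p. Qed.

Lemma hactPr c g x x' : h g (c *: x + x') = c *: h g x + h g x'.
Proof. by case: (hmodule_bilinear (pre_hmodule bE)) => _ p; apply: p. Qed.

End Prebimodule.

Ltac blin bE :=
  do ?[split | move=> ?];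
  repeat progress (lin_rules; rewrite ?actPl ?actPr ?(lmulPl bE) ?(lmulPr bE)
    ?(rmulPl bE) ?(rmulPr bE) ?(lipPl bE) ?(lipPr bE) ?(ripPl bE) ?(ripPr bE)
    ?(hactPl bE) ?(hactPr bE)); reflexivity.

Section PrebimoduleTheory.
Variables (R : realDomainType) (H : hopfStarAlgType R).
Variables (B A : hopfModStarAlgType H) (E : lmodType (cplx R)).
Variables (l : B -> E -> E) (r : E -> A -> E).
Variables (li : E -> E -> B) (ri : E -> E -> A) (h : H -> E -> E).
Hypothesis bE : prebimodule l r li ri h.
Implicit Types (c : cplx R) (x y z : E) (a : A) (b : B) (g : H).

Lemma ripMl x y a : ri (r x a) y = amul (star a) (ri x y).
Proof.
rewrite (rip_herm (pre_rip bE)) (rip_linear (pre_rip bE)) starM.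
by rewrite -(rip_herm (pre_rip bE)).
Qed.

Lemma lipMr b x y : li x (l b y) = amul (li x y) (star b).
Proof.
rewrite (lip_herm (pre_lip bE)) (lip_linear (pre_lip bE)) starM.
by rewrite -(lip_herm (pre_lip bE)).
Qed.

Lemma hact1 x : h 1 x = x.
Proof. exact: hmodule1 (pre_hmodule bE) x. Qed.

Lemma hactM g g' x : h (g * g') x = h g (h g' x).
Proof. exact: hmoduleA (pre_hmodule bE) g g' x. Qed.

Definition rip_cov : Prop := forall g x y, act g (ri x y) =
  sweedler (fun g1 g2 => ri (h (hstar (antipode g1)) x) (h g2 y)) (comul g).

(* Equivalent to [rip_cov], but free of the antipode. *)
Definition rip_cov' : Prop := forall g x y, ri x (h g y) =
  sweedler (fun g1 g2 => act g2 (ri (h (hstar g1) x) y)) (comul g).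

Definition lip_cov : Prop := forall g x y, act g (li x y) =
  sweedler (fun g1 g2 => li (h g1 x) (h (hstar (antipode g2)) y)) (comul g).

Definition lmul_cov : Prop := forall g b x, h g (l b x) =
  sweedler (fun g1 g2 => l (act g1 b) (h g2 x)) (comul g).

Definition rmul_cov : Prop := forall g x a, h g (r x a) =
  sweedler (fun g1 g2 => r (h g1 x) (act g2 a)) (comul g).

(** Inserting the covariance on the right makes S(g2)^* g1^* = (g1 S(g2))^* act on x, which the
    antipode axiom reduces to a counit. *)
Lemma rip_covW : rip_cov -> rip_cov'.
Proof.
move=> cov g x y; symmetry.
under eq_sweedler do rewrite cov.
rewrite -(@sweedlerA _ _ _ (fun g1 g2 g3 =>
  ri (h (hstar (antipode g2)) (h (hstar g1) x)) (h g3 y))); last by blin bE.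
rewrite -(@sweedler_counitl _ _ _ (fun g2 => ri x (h g2 y))); last by blin bE.
apply: eq_sweedler => g1 g2.
transitivity (sweedler (fun k m => ri (h (hstar (k * antipode m)) x) (h g2 y))
  (comul g1)).
  by apply: eq_sweedler => k m; rewrite hstarM hactM.
rewrite (@sweedler_antipoder _ _ _ (fun k => ri (h (hstar k) x) (h g2 y)));
  last by blin bE.
by rewrite hstar1 hact1.
Qed.

(** Mirror image of the previous argument: here g2^* S(g1)^* = (S(g1) g2)^* acts on x. *)
Lemma rip_cov'W : rip_cov' -> rip_cov.
Proof.
move=> cov g x y; symmetry.
under eq_sweedler do rewrite cov.
rewrite -(@sweedlerA _ _ _ (fun g1 g2 g3 =>
  act g3 (ri (h (hstar g2) (h (hstar (antipode g1)) x)) y))); last by blin bE.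
rewrite -(@sweedler_counitl _ _ _ (fun g2 => act g2 (ri x y))); last by blin bE.
apply: eq_sweedler => g1 g2.
transitivity (sweedler (fun k m => act g2 (ri (h (hstar (antipode k * m)) x) y))
  (comul g1)).
  by apply: eq_sweedler => k m; rewrite hstarM hactM.
rewrite (@sweedler_antipodel _ _ _ (fun k => act g2 (ri (h (hstar k) x) y)));
  last by blin bE.
by rewrite hstar1 hact1.
Qed.

(** Tested against y, the chain is <y, g (x a)> = g2 |> (<g1^* y, x> a) = (g2 |> <g1^* y, x>) (g3 |>
    a) = <y, g1 x> (g2 |> a). *)
Lemma rip_rmul_cov : rip_cov' -> forall g x a y, ri y (h g (r x a)) =
  ri y (sweedler (fun g1 g2 => r (h g1 x) (act g2 a)) (comul g)).
Proof.
move=> cov g x a y; rewrite cov.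
under eq_sweedler do rewrite (rip_linear (pre_rip bE)) actM.
rewrite -(@sweedlerA _ _ _ (fun g1 g2 g3 =>
  amul (act g2 (ri (h (hstar g1) y) x)) (act g3 a))); last by blin bE.
rewrite (linear_sweedler_out (L := ri y)); last by blin bE.
apply: eq_sweedler => g1 g2.
rewrite (rip_linear (pre_rip bE)) cov.
by rewrite (linear_sweedler_out (L := fun u => amul u _)); last by blin bE.
Qed.

Lemma rmul_cov_nondeg : nondegenerate_ip ri -> rip_cov' -> rmul_cov.
Proof.
move=> nd cov g x a; apply/eqP; rewrite -subr_eq0; apply/eqP/nd => y.
rewrite (rip_herm (pre_rip bE)) (linear_forB (f := ri y)); last by blin bE.
by rewrite rip_rmul_cov // subrr star0.
Qed.

Hypothesis lip_rip : forall x y z, l (li x y) z = r x (ri y z).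

(** By fullness b = <y, z> may be assumed. Then b x = y <z, x>, and g sends it to (g1 y) <S(g2)^* z,
    g3 x> = <g1 y, S(g2)^* z> (g3 x), whose first factor is g1 |> b after regrouping. *)
Lemma lmul_cov_lip : rip_cov -> lip_cov -> rmul_cov -> lmul_cov.
Proof.
move=> rcov lcov rmcov g b x.
move: b; apply: (spanning_ind (pre_lip_full bE)) => [|c b b' IHb IHb'|y z].
- rewrite (linear_for0 (f := l^~ x)); last by blin bE.
  rewrite (linear_for0 (f := h g)); last by blin bE.
  rewrite [RHS]big1 // => p _; rewrite (linear_for0 (act_linr _)).
  by rewrite (linear_for0 (f := l^~ _)); last by blin bE.
- rewrite (lmulPl bE) (hactPr bE) IHb IHb' -sweedler_linear_fun.
  by apply: eq_sweedler => g1 g2; rewrite actPr (lmulPl bE).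
rewrite lip_rip rmcov.
transitivity (sweedler (fun g1 g2 => sweedler (fun h1 h2 =>
    r (h g1 y) (ri (h (hstar (antipode h1)) z) (h h2 x))) (comul g2)) (comul g)).
  apply: eq_sweedler => g1 g2; rewrite rcov.
  by rewrite (linear_sweedler_out (L := r _)); last by blin bE.
rewrite -(@sweedlerA _ _ _ (fun g1 g2 g3 =>
  r (h g1 y) (ri (h (hstar (antipode g2)) z) (h g3 x)))); last by blin bE.
apply: eq_sweedler => g1 g2; rewrite lcov.
rewrite (linear_sweedler_out (L := fun u => l u _)); last by blin bE.
by apply: eq_sweedler => h1 h2; rewrite lip_rip.
Qed.

(** If b kills the module, then b <x, y> = <b x, y> = 0, and the values <x, y> span the algebra. *)
Lemma lmul_faithful b : nondegenerate_alg B -> (forall z, l b z = 0) -> b = 0.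
Proof.
move=> ndB lb; apply: ndB; left; apply: (spanned_linear (L := amul b)
  (P := fun u => u = 0) _ _ _ (pre_lip_full bE)) => //.
- exact: amul_linr.
- by move=> c u v -> ->; rewrite scaler0 addr0.
- move=> x y; rewrite -(lip_linear (pre_lip bE)) lb.
  by rewrite (linear_for0 (f := li^~ y)); last by blin bE.
Qed.

(** As an operator, g |> b is the adjoint action g1 b S(g2): covariance splits g1, and the leg next
    to S cancels. *)
Lemma act_lmul g b z : lmul_cov -> l (act g b) z =
  sweedler (fun g1 g2 => h g1 (l b (h (antipode g2) z))) (comul g).
Proof.
move=> cov; symmetry; under eq_sweedler do rewrite cov.
rewrite (@sweedlerA _ _ _ (fun g1 g2 g3 =>
  l (act g1 b) (h g2 (h (antipode g3) z)))); last by blin bE.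
rewrite -(@sweedler_counitr _ _ _ (fun k => l (act k b) z)); last by blin bE.
apply: eq_sweedler => g1 g2.
under eq_sweedler do rewrite -hactM.
rewrite (@sweedler_antipoder _ _ _ (fun k => l (act g1 b) (h k z)));
  last by blin bE.
by rewrite hact1.
Qed.

(** The same cancellation, used to move S(g)^* out of the first entry. *)
Lemma rip_antipode g y z : rip_cov -> ri (h (hstar (antipode g)) y) z =
  sweedler (fun g1 g2 => act g1 (ri y (h (antipode g2) z))) (comul g).
Proof.
move=> cov; symmetry; under eq_sweedler do rewrite cov.
rewrite (@sweedlerA _ _ _ (fun g1 g2 g3 =>
  ri (h (hstar (antipode g1)) y) (h g2 (h (antipode g3) z)))); last by blin bE.
rewrite -(@sweedler_counitr _ _ _ (fun k => ri (h (hstar (antipode k)) y) z));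
  last by blin bE.
apply: eq_sweedler => g1 g2.
under eq_sweedler do rewrite -hactM.
rewrite (@sweedler_antipoder _ _ _ (fun k =>
  ri (h (hstar (antipode g1)) y) (h k z))); last by blin bE.
by rewrite hact1.
Qed.

(** Both sides are compared as operators on z, which suffices by faithfulness: (g |> <x, y>) z = g1
    (x <y, S(g2) z>) = (g1 x) (g2 |> <y, S(g3) z>) = (g1 x) <S(g2)^* y, z>, and the exchange law
    turns this into <g1 x, S(g2)^* y> z. *)
Lemma lip_cov_lmul :
  nondegenerate_alg B -> rip_cov -> lmul_cov -> rmul_cov -> lip_cov.
Proof.
move=> ndB rcov lmcov rmcov g x y.
apply/eqP; rewrite -subr_eq0; apply/eqP/lmul_faithful => // z.
rewrite (linear_forB (f := l^~ z)); last by blin bE.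
apply/eqP; rewrite subr_eq0; apply/eqP.
rewrite act_lmul //; under eq_sweedler do rewrite lip_rip rmcov.
rewrite (@sweedlerA _ _ _ (fun g1 g2 g3 =>
  r (h g1 x) (act g2 (ri y (h (antipode g3) z))))); last by blin bE.
rewrite (linear_sweedler_out (L := fun b => l b z)); last by blin bE.
apply: eq_sweedler => g1 g2; rewrite lip_rip rip_antipode //.
by rewrite (linear_sweedler_out (L := r _)); last by blin bE.
Qed.

End PrebimoduleTheory.

Section BimoduleTheory.
Variables (R : realDomainType) (H : hopfStarAlgType R).
Variables (B A : hopfModStarAlgType H) (E : starEquivBimod B A).

Lemma bim_prebimodule :
  prebimodule (@lmul _ _ _ _ E) (@rmul _ _ _ _ E) (@lip _ _ _ _ E)
    (@rip _ _ _ _ E) (@hact _ _ _ _ E).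
Proof.
by split; [apply: bim_lmodule | apply: bim_rmodule | apply: bim_assoc
  | apply: bim_lip | apply: bim_rip | apply: bim_lip_full | apply: bim_rip_full
  | apply: bim_rip_lmul | apply: bim_lip_rmul | apply: bim_hmodule].
Qed.

Lemma bim_rip_cov' : rip_cov' (@rip _ _ _ _ E) (@hact _ _ _ _ E).
Proof. exact: rip_covW bim_prebimodule (@bim_act_rip _ _ _ _ E). Qed.

Lemma bim_rmul_cov : rmul_cov (@rmul _ _ _ _ E) (@hact _ _ _ _ E).
Proof.
exact: (rmul_cov_nondeg bim_prebimodule (@bim_rip_nondeg _ _ _ _ E)) bim_rip_cov'.
Qed.

Lemma bim_lmul_cov : lmul_cov (@lmul _ _ _ _ E) (@hact _ _ _ _ E).
Proof.
apply: (lmul_cov_lip bim_prebimodule (@bim_lip_rip _ _ _ _ E)).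
- exact: bim_act_rip.
- exact: bim_act_lip.
- exact: bim_rmul_cov.
Qed.

End BimoduleTheory.

(** * Conjugate bimodules and bimodules of isomorphisms *)

Section ConjugateBimodule.
Variables (R : realDomainType) (H : hopfStarAlgType R).
Variables (B A : hopfModStarAlgType H) (E : starEquivBimod B A).

Let bE := bim_prebimodule E.

Let cl (a : A) (x : conjmod E) : conjmod E := rmul (x : E) (star a).
Let cr (x : conjmod E) (b : B) : conjmod E := lmul (star b) (x : E).
Let cli (x y : conjmod E) : A := rip E x y.
Let cri (x y : conjmod E) : B := lip E x y.
(** The map g to S(g)^* is antilinear and, as a composite of two antimultiplicative maps,
    multiplicative; hence this is a linear action on the conjugate module. It is an involution by
    [antipode_star], which exchanges the two covariance conditions. *)
Let ch (g : H) (x : conjmod E) : conjmod E := hact (hstar (antipode g)) (x : E).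

(** Conjugation is a bijection of the scalars, so a module and its conjugate have the same spans. *)
Lemma conj_spanning (X Y X' Y' : Type) (V : lmodType (cplx R))
    (f : X -> Y -> V) (f' : X' -> Y' -> V) :
  (forall x y, exists x' y', f x y = f' x' y') ->
  spanning f -> spanning (f' : _ -> _ -> conjmod V).
Proof.
move=> ff' fS.
suff spanV (v : V) : @spanned _ _ _ (conjmod V) f' v by exact: spanV.
move: v; apply: (spanning_ind fS) => [|c u v Pu Pv|x y].
- exact: (@spanned0 _ _ _ (conjmod V)).
- by rewrite -[c]cconjK; apply: (@spanned_lin _ _ _ (conjmod V)).
- by have [x' [y' ->]] := ff' x y; exact: (@spanned_gen _ _ _ (conjmod V)).
Qed.

Fact conj_lmodule : left_module cl.
Proof.
split=> [|a b x|e ue x].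
- split=> [x c a a' | a c x x']; last exact: (rmulPl bE).
  by rewrite /cl starP; exact: (rmulPr bE).
- by rewrite /cl starM (rmoduleA (pre_rmodule bE)).
- by rewrite /cl star_unit // (rmodule_unit (pre_rmodule bE)).
Qed.

Fact conj_rmodule : right_module cr.
Proof.
split=> [|x a b|e ue x].
- split=> [b c x x' | x c b b']; first exact: (lmulPr bE).
  by rewrite /cr starP; exact: (lmulPl bE).
- by rewrite /cr starM (lmoduleA (pre_lmodule bE)).
- by rewrite /cr star_unit // (lmodule_unit (pre_lmodule bE)).
Qed.

Fact conj_lip : left_inner_product cl cli.
Proof.
split=> [|a x y|x y].
- split=> [y c x x' | x c y y']; last exact: (ripPr bE).
  by rewrite /cli conjmod_scaleE (ripPl bE) cconjK.
- by rewrite /cli /cl (ripMl bE) starK.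
- exact: rip_herm (pre_rip bE) _ _.
Qed.

Fact conj_rip : right_inner_product cr cri.
Proof.
split=> [|x y b|x y].
- split=> [y c x x' | x c y y']; first exact: (lipPl bE).
  by rewrite /cri conjmod_scaleE (lipPr bE) cconjK.
- by rewrite /cri /cr (lipMr bE) starK.
- exact: lip_herm (pre_lip bE) _ _.
Qed.

Fact conj_hmodule : hopf_module ch.
Proof.
split=> [|x|g g' x].
- split=> [x c g g' | g c x x']; last exact: (hactPr bE).
  by rewrite /ch antipodeP hstarP; exact: (hactPl bE).
- by rewrite /ch antipode1 hstar1 (hact1 bE).
- by rewrite /ch antipodeM hstarM (hactM bE).
Qed.

Definition conj_bimod : starEquivBimod A B.
Proof.
refine (@StarEquivBimod R H A B (conjmod E) cl cr cli cri ch
  conj_lmodule conj_rmodule _ _ _ conj_lip conj_rip _ _ _ _ _ _ _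
  conj_hmodule _ _).
- by move=> a x b; rewrite /cl /cr -(pre_assoc bE).
- apply: (conj_spanning (f := @rmul _ _ _ _ E)); last exact: bim_rspan.
  by move=> x a; exists (star a), x; rewrite /cl starK.
- apply: (conj_spanning (f := @lmul _ _ _ _ E)); last exact: bim_lspan.
  by move=> b x; exists x, (star b); rewrite /cr starK.
- exact: bim_rip_nondeg.
- exact: bim_lip_nondeg.
- exact: bim_rip_full.
- exact: bim_lip_full.
- by move=> a x y; rewrite /cri /cl starK (pre_lip_rmul bE) starK.
- by move=> x b y; rewrite /cli /cr starK (pre_rip_lmul bE) starK.
- move=> x y z; rewrite /cli /cri /cl /cr -(rip_herm (pre_rip bE)).
  by rewrite -(lip_herm (pre_lip bE)) bim_lip_rip.
- move=> g x y; rewrite /cri bim_act_lip; apply: eq_sweedler => g1 g2.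
  by rewrite /ch antipode_star.
- move=> g x y; rewrite /cli bim_act_rip; apply: eq_sweedler => g1 g2.
  by rewrite /ch antipode_star.
Defined.

End ConjugateBimodule.

Section IsoBimodule.
Variables (R : realDomainType) (H : hopfStarAlgType R).
Variables (A B : idemNondegAlg H) (Phi : {linear A -> B}) (Psi : B -> A).
Hypotheses (isoP : equivariant_star_iso Phi) (PhiK : cancel Phi Psi).
Hypothesis (PsiK : cancel Psi Phi).

Let idemA : idempotent_alg A := @ina_idempotent _ _ A.
Let ndA : nondegenerate_alg A := @ina_nondegenerate _ _ A.
Let Phi_lin : linear Phi. Proof. exact: linearP. Qed.
Let Phi_inj : injective Phi. Proof. exact: can_inj PhiK. Qed.

Let Psi_lin : linear Psi.
Proof. by move=> c a b; apply: Phi_inj; rewrite Phi_lin !PsiK. Qed.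

Let PsiM : {morph Psi : a b / amul a b}.
Proof. by move=> a b; apply: Phi_inj; rewrite (iso_mul isoP) !PsiK. Qed.

Let Psi_star : {morph Psi : a / star a}.
Proof. by move=> a; apply: Phi_inj; rewrite (iso_star isoP) !PsiK. Qed.

Let il (b : B) (x : A) : A := amul (Psi b) x.
Let ili (x y : A) : B := Phi (amul x (star y)).
Let iri (x y : A) : A := amul (star x) y.

Fact iso_lmodule : left_module il.
Proof.
split=> [|a b x|e ue x].
- by split=> [x c b b' | b c x x']; rewrite /il ?Psi_lin ?amulPl ?amulPr.
- by rewrite /il PsiM amulA.
- have u a : amul (Psi e) a = a.
    by apply: Phi_inj; rewrite (iso_mul isoP) PsiK (ue _).1.
  exact: u.
Qed.

Fact mul_rmodule : right_module (@amul R A : A -> A -> A).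
Proof.
split=> [|x a b|e ue x]; [exact: amul_bilinear | exact: amulA | exact: (ue x).2].
Qed.

Fact iso_lip : left_inner_product il ili.
Proof.
split=> [|a x y|x y].
- by split=> [y c x x' | x c y y']; rewrite /ili ?starP ?amulPl ?amulPr Phi_lin.
- by rewrite /ili /il -amulA (iso_mul isoP) PsiK.
- by rewrite /ili -(iso_star isoP) starM starK.
Qed.

Fact mul_rip : right_inner_product (@amul R A : A -> A -> A) iri.
Proof.
split=> [|x y a|x y].
- by split=> [y c x x' | x c y y']; rewrite /iri ?starP ?amulPl ?amulPr.
- by rewrite /iri amulA.
- by rewrite /iri starM starK.
Qed.

Fact act_hopf_module : hopf_module (@act R H A : H -> A -> A).
Proof.
by split; [exact: act_bilinear | exact: act1 | exact: actA].
Qed.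

(** The reason why S(g)^* occurs in the covariance conditions: under the star of an inner product
    such as x^* y it becomes g itself, so covariance reduces to [actM]. *)
Lemma star_act_antipode (g : H) (a : A) :
  star (act (hstar (antipode g)) a) = act g (star a).
Proof. by rewrite act_star antipode_star. Qed.

(** The two spanning and two fullness conditions are idempotence of [A], since up to bijections all
    four maps are its product; both inner products are nondegenerate because [A] is. *)
Definition iso_bimod : starEquivBimod B A.
Proof.
refine (@StarEquivBimod R H B A A il (@amul R A) ili iri (@act R H A)
  iso_lmodule mul_rmodule _ _ idemA iso_lip mul_rip _ _ _ _ _ _ _
  act_hopf_module _ _).
- by move=> b x a; rewrite /il amulA.
- apply: (spanning_surj (L := id) _ _ _ idemA) => // [w|x y]; first by exists w.
  by exists (Phi x), y; rewrite /il PhiK.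
- move=> x xP; apply: ndA; left => b; apply: Phi_inj.
  by rewrite -[b]starK [LHS]xP (linear_for0 Phi_lin).
- move=> x xP; apply: star_inj; rewrite star0; apply: ndA; left => b.
  exact: xP.
- apply: (spanning_surj Phi_lin _ _ idemA) => [w|x y].
    by exists (Psi w).
  by exists x, (star y); rewrite /ili starK.
- apply: (spanning_surj (L := id) _ _ _ idemA) => // [w|x y]; first by exists w.
  by exists (star x), y; rewrite /iri starK.
- by move=> b x y; rewrite /iri /il Psi_star starM amulA.
- by move=> x a y; rewrite /ili starM starK amulA.
- by move=> x y z; rewrite /il /ili /iri PhiK amulA.
- move=> g x y; rewrite /iri actM; apply: eq_sweedler => g1 g2.
  by rewrite star_act_antipode.
- move=> g x y; rewrite /ili -(iso_act isoP) actM (linear_sweedler_out _ _ Phi_lin).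
  by apply: eq_sweedler => g1 g2; rewrite star_act_antipode.
Defined.

End IsoBimodule.

(** * Tensor products *)

Section TensorBimodule.
Variables (R : realDomainType) (H : hopfStarAlgType R).
Variables (D B A : hopfModStarAlgType H).
Variables (F : starEquivBimod D B) (E : starEquivBimod B A).

Let bF := bim_prebimodule F.
Let bE := bim_prebimodule E.
Let V := tensor F E.
Implicit Types (c : cplx R) (y : F) (x : E) (t : V) (g : H).

Let tensPl c y y' x : tens (c *: y + y') x = c *: tens y x + tens y' x.
Proof. by case: (@tens_bilinear _ F E) => p _; apply: p. Qed.

Let tensPr c y x x' : tens y (c *: x + x') = c *: tens y x + tens y x'.
Proof. by case: (@tens_bilinear _ F E) => _ p; apply: p. Qed.

Ltac tlin := do ?[split | move=> ?];
  repeat progress (rewrite ?tensPl ?tensPr;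
    lin_rules; rewrite ?actPl ?actPr
    ?(lmulPl bE) ?(lmulPr bE) ?(rmulPl bE) ?(rmulPr bE) ?(lipPl bE) ?(lipPr bE)
    ?(ripPl bE) ?(ripPr bE) ?(hactPl bE) ?(hactPr bE)
    ?(lmulPl bF) ?(lmulPr bF) ?(rmulPl bF) ?(rmulPr bF) ?(lipPl bF) ?(lipPr bF)
    ?(ripPl bF) ?(ripPr bF) ?(hactPl bF) ?(hactPr bF)); reflexivity.

Definition tens_lmul (d : D) t : V := sweedler (fun y x => tens (lmul d y) x) t.

Definition tens_rmul t (a : A) : V := sweedler (fun y x => tens y (rmul x a)) t.

Definition tens_lip t t' : D := sweedler (fun y x =>
  sweedler (fun y' x' => lip F (rmul y (lip E x x')) y') t') t.

Definition tens_rip t t' : A := sweedler (fun y x =>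
  sweedler (fun y' x' => rip E x (lmul (rip F y y') x')) t') t.

Definition tens_hact g t : V := sweedler (fun g1 g2 =>
  sweedler (fun y x => tens (hact g1 y) (hact g2 x)) t) (comul g).

Lemma tens_lmulE d y x : tens_lmul d (tens y x) = tens (lmul d y) x.
Proof. by rewrite /tens_lmul sweedler_tens //; tlin. Qed.

Lemma tens_lmulPl c d d' t :
  tens_lmul (c *: d + d') t = c *: tens_lmul d t + tens_lmul d' t.
Proof.
by rewrite -sweedler_linear_fun; apply: eq_sweedler => y x; tlin.
Qed.

Lemma tens_lmulPr c d t t' :
  tens_lmul d (c *: t + t') = c *: tens_lmul d t + tens_lmul d t'.
Proof. by apply: linear_sweedler; tlin. Qed.

Lemma tens_rmulE y x a : tens_rmul (tens y x) a = tens y (rmul x a).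
Proof. by rewrite /tens_rmul sweedler_tens //; tlin. Qed.

Lemma tens_rmulPl c t t' a :
  tens_rmul (c *: t + t') a = c *: tens_rmul t a + tens_rmul t' a.
Proof. by apply: linear_sweedler; tlin. Qed.

Lemma tens_rmulPr c t a a' :
  tens_rmul t (c *: a + a') = c *: tens_rmul t a + tens_rmul t a'.
Proof.
by rewrite -sweedler_linear_fun; apply: eq_sweedler => y x; tlin.
Qed.

(** Antilinearity in the second tensor, phrased as bilinearity into [conjmod D] so that
    [sweedler_tens] and [linear_sweedler] apply. *)
Let lip_in_bilinear y x :
  bilinear2 (fun y' x' => lip F (rmul y (lip E x x')) y' : conjmod D).
Proof.
split=> [x' c y1 y2 | y' c x1 x2]; first exact: (lipPr bF).
by rewrite (lipPr bE) (rmulPr bF) (lipPl bF).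
Qed.

Let lip_out_bilinear t' : bilinear2 (fun y x =>
  sweedler (fun y' x' => lip F (rmul y (lip E x x')) y') t').
Proof.
by split=> [x c y1 y2 | y c x1 x2]; rewrite -sweedler_linear_fun;
  apply: eq_sweedler => y' x'; tlin.
Qed.

Lemma tens_lipE y x y' x' :
  tens_lip (tens y x) (tens y' x') = lip F (rmul y (lip E x x')) y'.
Proof.
rewrite /tens_lip (sweedler_tens (lip_out_bilinear _)).
exact: (sweedler_tens (lip_in_bilinear y x)).
Qed.

Lemma tens_lipPl c t1 t2 t :
  tens_lip (c *: t1 + t2) t = c *: tens_lip t1 t + tens_lip t2 t.
Proof. exact: linear_sweedler (lip_out_bilinear _) _ _ _. Qed.

Lemma tens_lipPr c t t1 t2 :
  tens_lip t (c *: t1 + t2) = cconj c *: tens_lip t t1 + tens_lip t t2.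
Proof.
rewrite -sweedler_linear_fun; apply: eq_sweedler => y x.
exact: (linear_sweedler (lip_in_bilinear y x)).
Qed.

Let rip_in_bilinear y x :
  bilinear2 (fun y' x' => rip E x (lmul (rip F y y') x')).
Proof. by tlin. Qed.

Let rip_out_bilinear t' : bilinear2 (fun y x =>
  sweedler (fun y' x' => rip E x (lmul (rip F y y') x')) t' : conjmod A).
Proof.
by split=> [x c y1 y2 | y c x1 x2];
  apply: etrans (sweedler_linear_fun (W := conjmod A) _ _ _ _);
  apply: eq_sweedler => y' x'; tlin.
Qed.

Lemma tens_ripE y x y' x' :
  tens_rip (tens y x) (tens y' x') = rip E x (lmul (rip F y y') x').
Proof.
rewrite /tens_rip (sweedler_tens (rip_out_bilinear _)).
exact: (sweedler_tens (rip_in_bilinear y x)).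
Qed.

Lemma tens_ripPl c t1 t2 t :
  tens_rip (c *: t1 + t2) t = cconj c *: tens_rip t1 t + tens_rip t2 t.
Proof. exact: linear_sweedler (rip_out_bilinear _) _ _ _. Qed.

Lemma tens_ripPr c t t1 t2 :
  tens_rip t (c *: t1 + t2) = c *: tens_rip t t1 + tens_rip t t2.
Proof.
rewrite -sweedler_linear_fun; apply: eq_sweedler => y x.
exact: (linear_sweedler (rip_in_bilinear y x)).
Qed.

Let hact_in_bilinear (g1 g2 : H) :
  bilinear2 (fun y x => tens (hact g1 y : F) (hact g2 x : E)).
Proof. by tlin. Qed.

Let hact_out_bilinear t : bilinear2 (fun g1 g2 : H =>
  sweedler (fun y x => tens (hact g1 y : F) (hact g2 x : E)) t).
Proof.
by split=> [g2 c g g' | g1 c g g']; rewrite -sweedler_linear_fun;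
  apply: eq_sweedler => y x; tlin.
Qed.

Lemma tens_hactE g y x : tens_hact g (tens y x) =
  sweedler (fun g1 g2 => tens (hact g1 y) (hact g2 x)) (comul g).
Proof. by apply: eq_sweedler => g1 g2; rewrite sweedler_tens. Qed.

Lemma tens_hactPl c g g' t :
  tens_hact (c *: g + g') t = c *: tens_hact g t + tens_hact g' t.
Proof. exact: comul_bilinear. Qed.

Lemma tens_hactPr c g t t' :
  tens_hact g (c *: t + t') = c *: tens_hact g t + tens_hact g t'.
Proof.
rewrite -sweedler_linear_fun; apply: eq_sweedler => g1 g2.
exact: linear_sweedler.
Qed.

Fact tens_lmodule : left_module tens_lmul.
Proof.
split=> [|d d'|e ue].
- by split=> ? ? ? ?; [exact: tens_lmulPl | exact: tens_lmulPr].
- apply: tensor_ind => [c t t' IH IH' | y x].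
    by rewrite !tens_lmulPr IH IH'.
  by rewrite !tens_lmulE (lmoduleA (pre_lmodule bF)).
- apply: tensor_ind => [c t t' IH IH' | y x].
    by rewrite !tens_lmulPr IH IH'.
  by rewrite tens_lmulE (lmodule_unit (pre_lmodule bF)).
Qed.

Fact tens_rmodule : right_module tens_rmul.
Proof.
split=> [|t a b|e ue].
- by split=> ? ? ? ?; [exact: tens_rmulPl | exact: tens_rmulPr].
- move: t; apply: tensor_ind => [c t t' IH IH' | y x].
    by rewrite !tens_rmulPl IH IH'.
  by rewrite !tens_rmulE (rmoduleA (pre_rmodule bE)).
- apply: tensor_ind => [c t t' IH IH' | y x].
    by rewrite !tens_rmulPl IH IH'.
  by rewrite tens_rmulE (rmodule_unit (pre_rmodule bE)).
Qed.

Fact tens_lipP : left_inner_product tens_lmul tens_lip.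
Proof.
split=> [|d t t'|].
- by split=> ? ? ? ?; [exact: tens_lipPl | exact: tens_lipPr].
- move: t t'; apply: tensor_ind => [c t1 t2 IH1 IH2 t' | y x].
    by rewrite tens_lmulPr !tens_lipPl IH1 IH2 amulPr.
  apply: tensor_ind => [c t1 t2 IH1 IH2 | y' x'].
    by rewrite !tens_lipPr IH1 IH2 amulPr.
  by rewrite tens_lmulE !tens_lipE (pre_assoc bF) (lip_linear (pre_lip bF)).
- apply: tensor_ind => [c t1 t2 IH1 IH2 t' | y x].
    by rewrite tens_lipPl tens_lipPr starP cconjK IH1 IH2.
  apply: tensor_ind => [c t1 t2 IH1 IH2 | y' x'].
    by rewrite tens_lipPl tens_lipPr starP IH1 IH2.
  rewrite !tens_lipE -(lip_herm (pre_lip bF)) (pre_lip_rmul bF).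
  by rewrite -(lip_herm (pre_lip bE)).
Qed.

Fact tens_ripP : right_inner_product tens_rmul tens_rip.
Proof.
split=> [|t t' a|].
- by split=> ? ? ? ?; [exact: tens_ripPl | exact: tens_ripPr].
- move: t t'; apply: tensor_ind => [c t1 t2 IH1 IH2 t' | y x].
    by rewrite !tens_ripPl IH1 IH2 amulPl.
  apply: tensor_ind => [c t1 t2 IH1 IH2 | y' x'].
    by rewrite tens_rmulPl !tens_ripPr IH1 IH2 amulPl.
  by rewrite tens_rmulE !tens_ripE -(pre_assoc bE) (rip_linear (pre_rip bE)).
- apply: tensor_ind => [c t1 t2 IH1 IH2 t' | y x].
    by rewrite tens_ripPl tens_ripPr starP IH1 IH2.
  apply: tensor_ind => [c t1 t2 IH1 IH2 | y' x'].
    by rewrite tens_ripPl tens_ripPr starP cconjK IH1 IH2.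
  rewrite !tens_ripE -(rip_herm (pre_rip bE)) (pre_rip_lmul bE).
  by rewrite -(rip_herm (pre_rip bF)).
Qed.

Fact tens_lspan : spanning tens_lmul.
Proof.
have S0 := spanned0 tens_lmul; have SD := @spanned_lin _ _ _ _ tens_lmul.
suff S y x : spanned tens_lmul (tens y x).
  by apply: tensor_ind; [exact: SD | exact: S].
have lx : linear (fun y => tens y x) by tlin.
refine (@spanned_linear _ _ _ _ _ _ _ _ lx S0 SD (@bim_lspan _ _ _ _ F) _ y).
by move=> d y'; rewrite -tens_lmulE; apply: (spanned_gen tens_lmul).
Qed.

Fact tens_rspan : spanning tens_rmul.
Proof.
have S0 := spanned0 tens_rmul; have SD := @spanned_lin _ _ _ _ tens_rmul.
suff S y x : spanned tens_rmul (tens y x).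
  by apply: tensor_ind; [exact: SD | exact: S].
have ly : linear (fun x => tens y x) by tlin.
refine (@spanned_linear _ _ _ _ _ _ _ _ ly S0 SD (@bim_rspan _ _ _ _ E) _ x).
by move=> x' a; rewrite -tens_rmulE; apply: (spanned_gen tens_rmul).
Qed.

(** A generator <y, y'> of D is reached by expanding y in F B = F, and then the element of B in
    values <x, x'>. The A-valued case expands x' in B E = E instead. *)
Fact tens_lip_full : full_ip tens_lip.
Proof.
have S0 := spanned0 tens_lip; have SD := @spanned_lin _ _ _ _ tens_lip.
apply: (spanning_ind (P := spanned tens_lip) (pre_lip_full bF) S0 SD) => y y'.
have ly : linear (fun y => lip F y y') by tlin.
refine (@spanned_linear _ _ _ _ _ _ _ _ ly S0 SD (@bim_rspan _ _ _ _ F) _ y).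
move=> {}y b; have lb : linear (fun b => lip F (rmul y b) y') by tlin.
refine (@spanned_linear _ _ _ _ _ _ _ _ lb S0 SD (pre_lip_full bE) _ b).
by move=> x x'; rewrite -tens_lipE; apply: (spanned_gen tens_lip).
Qed.

Fact tens_rip_full : full_ip tens_rip.
Proof.
have S0 := spanned0 tens_rip; have SD := @spanned_lin _ _ _ _ tens_rip.
apply: (spanning_ind (P := spanned tens_rip) (pre_rip_full bE) S0 SD) => x x'.
have lx : linear (rip E x) by tlin.
refine (@spanned_linear _ _ _ _ _ _ _ _ lx S0 SD (@bim_lspan _ _ _ _ E) _ x').
move=> b {}x'; have lb : linear (fun b => rip E x (lmul b x')) by tlin.
refine (@spanned_linear _ _ _ _ _ _ _ _ lb S0 SD (pre_rip_full bF) _ b).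
by move=> y y'; rewrite -tens_ripE; apply: (spanned_gen tens_rip).
Qed.

Fact tens_hmodule : hopf_module tens_hact.
Proof.
split=> [||g g'].
- by split=> ? ? ? ?; [exact: tens_hactPl | exact: tens_hactPr].
- apply: tensor_ind => [c t t' IH IH' | y x].
    by rewrite tens_hactPr IH IH'.
  rewrite tens_hactE comul1 sweedler_tens; last by tlin.
  by rewrite (hact1 bF) (hact1 bE).
- apply: tensor_ind => [c t t' IH IH' | y x].
    by rewrite !tens_hactPr IH IH'.
  rewrite !tens_hactE sweedler_comulM; last by tlin.
  rewrite (linear_sweedler_out (L := tens_hact g)) => [|c t t'];
    last exact: tens_hactPr.
  rewrite exchange_sweedler; apply: eq_sweedler => h1 h2; rewrite tens_hactE.
  by apply: eq_sweedler => g1 g2; rewrite (hactM bF) (hactM bE).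
Qed.

Lemma tens_prebimodule :
  prebimodule tens_lmul tens_rmul tens_lip tens_rip tens_hact.
Proof.
split.
- exact: tens_lmodule.
- exact: tens_rmodule.
- move=> d t a; move: t; apply: tensor_ind => [c t t' IH IH' | y x].
    by rewrite tens_lmulPr !tens_rmulPl tens_lmulPr IH IH'.
  by rewrite tens_lmulE !tens_rmulE tens_lmulE.
- exact: tens_lipP.
- exact: tens_ripP.
- exact: tens_lip_full.
- exact: tens_rip_full.
- move=> d; apply: tensor_ind => [c t1 t2 IH1 IH2 t' | y x].
    by rewrite tens_lmulPr !tens_ripPl IH1 IH2.
  apply: tensor_ind => [c t1 t2 IH1 IH2 | y' x'].
    by rewrite tens_lmulPr !tens_ripPr IH1 IH2.
  by rewrite !tens_lmulE !tens_ripE (pre_rip_lmul bF).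
- move=> t a; move: t; apply: tensor_ind => [c t1 t2 IH1 IH2 t' | y x].
    by rewrite tens_rmulPl !tens_lipPl IH1 IH2.
  apply: tensor_ind => [c t1 t2 IH1 IH2 | y' x'].
    by rewrite tens_rmulPl !tens_lipPr IH1 IH2.
  by rewrite !tens_rmulE !tens_lipE (pre_lip_rmul bE).
- exact: tens_hmodule.
Qed.

(* The two sides agree only up to the degeneracy space, which contains the
   relations y b (x) x = y (x) b x. *)
Lemma tens_lip_rip t t' t'' w :
  tens_rip (tens_lmul (tens_lip t t') t'') w =
  tens_rip (tens_rmul t (tens_rip t' t'')) w.
Proof.
move: t t' t'' w; apply: tensor_ind => [c t1 t2 IH1 IH2 t' t'' w | y x].
  by rewrite tens_lipPl tens_lmulPl tens_rmulPl !tens_ripPl IH1 IH2.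
apply: tensor_ind => [c t1 t2 IH1 IH2 t'' w | y' x'].
  by rewrite tens_lipPr tens_lmulPl !tens_ripPl tens_rmulPr tens_ripPl IH1 IH2.
apply: tensor_ind => [c t1 t2 IH1 IH2 w | y'' x''].
  by rewrite tens_lmulPr !tens_ripPl tens_ripPr tens_rmulPr tens_ripPl IH1 IH2.
apply: tensor_ind => [c t1 t2 IH1 IH2 | v u].
  by rewrite !tens_ripPr IH1 IH2.
rewrite tens_lipE tens_lmulE !tens_ripE tens_rmulE tens_ripE.
(* The exchange law of F turns the left side into y times elements of B; that of E turns x <x', z>
   into <x, x'> z. Both sides then differ only by adjoints of elements of B acting on E. *)
rewrite (@bim_lip_rip _ _ _ _ F) -(@bim_lip_rip _ _ _ _ E) !(ripMl bF).
rewrite !(lmoduleA (pre_lmodule bE)).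
by rewrite -!(pre_rip_lmul bE).
Qed.

Lemma tens_lmul_cov : lmul_cov tens_lmul tens_hact.
Proof.
move=> g d; apply: tensor_ind => [c t1 t2 IH1 IH2 | y x].
  rewrite tens_lmulPr tens_hactPr IH1 IH2 -sweedler_linear_fun.
  by apply: eq_sweedler => g1 g2; rewrite tens_hactPr tens_lmulPr.
rewrite tens_lmulE tens_hactE.
under eq_sweedler do rewrite bim_lmul_cov.
transitivity (sweedler (fun g1 g2 => sweedler (fun h1 h2 =>
    tens (lmul (act h1 d) (hact h2 y)) (hact g2 x)) (comul g1)) (comul g)).
  apply: eq_sweedler => g1 g2.
  by rewrite (linear_sweedler_out (L := fun v : F => tens v _)); last by tlin.
rewrite (@sweedlerA _ _ _ (fun g1 g2 g3 =>
  tens (lmul (act g1 d) (hact g2 y)) (hact g3 x))); last by tlin.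
apply: eq_sweedler => g1 g2; rewrite tens_hactE.
rewrite (linear_sweedler_out (L := tens_lmul _)) => [|c t t'];
  last exact: tens_lmulPr.
by apply: eq_sweedler => h1 h2; rewrite tens_lmulE.
Qed.

(** In order: <x, <y, g1 y'> g2 x'> = <x, (g2 |> <g1^* y, y'>) (g3 x')> = <x, g2 (<g1^* y, y'> x')>
    = g3 |> <g2^* x, <g1^* y, y'> x'>. The legs g1^*, g2^* recombine because the coproduct commutes
    with the star; the form with S would call for the behaviour of the coproduct on S(g). *)
Lemma tens_rip_cov' : rip_cov' tens_rip tens_hact.
Proof.
move=> g; apply: tensor_ind => [c t1 t2 IH1 IH2 t | y x].
  rewrite tens_ripPl IH1 IH2 -sweedler_linear_fun.
  by apply: eq_sweedler => g1 g2; rewrite tens_hactPr tens_ripPl actPr.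
apply: tensor_ind => [c t1 t2 IH1 IH2 | y' x'].
  rewrite tens_hactPr tens_ripPr IH1 IH2 -sweedler_linear_fun.
  by apply: eq_sweedler => g1 g2; rewrite tens_ripPr actPr.
rewrite tens_hactE (linear_sweedler_out (L := tens_rip _)) => [|c t t'];
  last exact: tens_ripPr.
transitivity (sweedler (fun g1 g2 => sweedler (fun h1 h2 => rip E x
    (lmul (act h2 (rip F (hact (hstar h1) y) y')) (hact g2 x'))) (comul g1))
    (comul g)).
  apply: eq_sweedler => g1 g2; rewrite tens_ripE bim_rip_cov'.
  by rewrite (linear_sweedler_out (L := fun b => rip E x (lmul b _)));
    last by tlin.
rewrite (@sweedlerA _ _ _ (fun g1 g2 g3 => rip E x
  (lmul (act g2 (rip F (hact (hstar g1) y) y')) (hact g3 x')))); last by tlin.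
transitivity (sweedler (fun g1 g2 => sweedler (fun h1 h2 => act h2
    (rip E (hact (hstar h1) x) (lmul (rip F (hact (hstar g1) y) y') x')))
    (comul g2)) (comul g)).
  apply: eq_sweedler => g1 g2; rewrite -bim_rip_cov' bim_lmul_cov.
  by rewrite (linear_sweedler_out (L := rip E x)); last by tlin.
rewrite -(@sweedlerA _ _ _ (fun g1 g2 g3 => act g3
  (rip E (hact (hstar g2) x) (lmul (rip F (hact (hstar g1) y) y') x'))));
  last by tlin.
apply: eq_sweedler => g1 g2; rewrite tens_hactE sweedler_comul_star; last by tlin.
rewrite (linear_sweedler_out (W' := conjmod A) (L := fun t => tens_rip t _));
  last by move=> c t t'; exact: tens_ripPl.
rewrite (linear_sweedler_out (L := act g2) (W := A)); last exact: act_linr.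
by apply: eq_sweedler => h1 h2; rewrite tens_ripE.
Qed.

End TensorBimodule.

(** * Reduction by the degeneracy space *)

Section QuotientModule.
Variables (C : comNzRingType) (V : lmodType C).

Record submodule : Type := Submodule {
  submod_pred :> V -> Prop;
  submod0 : submod_pred 0;
  submodP : forall c x y,
    submod_pred x -> submod_pred y -> submod_pred (c *: x + y)
}.

Variable N : submodule.

Definition quot_rel : rel V := fun x y => `[< N (x - y) >].

Let submodZ c x : N x -> N (c *: x).
Proof. by move=> Nx; rewrite -[_ *: x]addr0; apply/submodP/submod0. Qed.

Let submodD x y : N x -> N y -> N (x + y).
Proof. by move=> Nx Ny; rewrite -[x]scale1r; apply: submodP. Qed.

Fact quot_rel_refl : reflexive quot_rel.
Proof. by move=> x; apply/asboolP; rewrite subrr; apply: submod0. Qed.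

Fact quot_rel_sym : symmetric quot_rel.
Proof.
by move=> x y; apply/asboolP/asboolP => Nxy; rewrite -opprB -scaleN1r;
  apply: submodZ.
Qed.

Fact quot_rel_trans : transitive quot_rel.
Proof.
move=> y x z /asboolP Nxy /asboolP Nyz; apply/asboolP.
by rewrite -[x](subrK y) -addrA; apply: submodD.
Qed.

Canonical quot_equiv :=
  EquivRel quot_rel quot_rel_refl quot_rel_sym quot_rel_trans.

Definition quot_mod : Type := {eq_quot quot_equiv}.
HB.instance Definition _ := Choice.on quot_mod.
HB.instance Definition _ := EqQuotient.on quot_mod.

Lemma quot_piP x y : N (x - y) <-> \pi_quot_mod x = \pi_quot_mod y.
Proof.
split=> [Nxy | /eqmodP]; first by apply/eqmodP; apply/asboolP.
by move=> /asboolP.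
Qed.

Lemma quot_repr x : N (repr (\pi_quot_mod x) - x).
Proof. by apply/quot_piP; rewrite reprK. Qed.

Definition quot_add (p q : quot_mod) : quot_mod :=
  \pi_quot_mod (repr p + repr q).
Definition quot_scale (c : C) (p : quot_mod) : quot_mod :=
  \pi_quot_mod (c *: repr p).
Definition quot_opp (p : quot_mod) : quot_mod := quot_scale (-1) p.

Let addE x y : quot_add (\pi_quot_mod x) (\pi_quot_mod y) = \pi_quot_mod (x + y).
Proof.
by apply/quot_piP; rewrite opprD addrACA; apply: submodD; apply: quot_repr.
Qed.

Let scaleE c x : quot_scale c (\pi_quot_mod x) = \pi_quot_mod (c *: x).
Proof. by apply/quot_piP; rewrite -scalerBr; apply/submodZ/quot_repr. Qed.

Let piW (P : quot_mod -> Prop) : (forall x, P (\pi_quot_mod x)) -> forall q, P q.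
Proof. by move=> Px q; rewrite -[q]reprK; apply: Px. Qed.

Fact quot_addA : associative quot_add.
Proof. by do 3!elim/piW => ?; rewrite !addE addrA. Qed.

Fact quot_addC : commutative quot_add.
Proof. by do 2!elim/piW => ?; rewrite !addE addrC. Qed.

Fact quot_add0 : left_id (\pi_quot_mod 0) quot_add.
Proof. by elim/piW => ?; rewrite addE add0r. Qed.

Fact quot_addN : left_inverse (\pi_quot_mod 0) quot_opp quot_add.
Proof. by elim/piW => x; rewrite /quot_opp scaleE addE scaleN1r addNr. Qed.

HB.instance Definition _ :=
  GRing.isZmodule.Build quot_mod quot_addA quot_addC quot_add0 quot_addN.

Fact quot_scaleA c d q : quot_scale c (quot_scale d q) = quot_scale (c * d) q.
Proof. by elim/piW: q => x; rewrite !scaleE scalerA. Qed.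

Fact quot_scale1 : left_id 1 quot_scale.
Proof. by elim/piW => x; rewrite scaleE scale1r. Qed.

Fact quot_scaleDr : right_distributive quot_scale +%R.
Proof.
by move=> c; do 2!elim/piW => ?; rewrite /GRing.add /= addE !scaleE addE scalerDr.
Qed.

Fact quot_scaleDl q : {morph quot_scale^~ q : c d / c + d}.
Proof.
by elim/piW: q => x c d; rewrite !scaleE [RHS]addE scalerDl.
Qed.

HB.instance Definition _ := GRing.Zmodule_isLmodule.Build C quot_mod
  quot_scaleA quot_scale1 quot_scaleDr quot_scaleDl.

Lemma quot_pi_linear : linear (\pi_quot_mod : V -> quot_mod).
Proof.
move=> c x y; rewrite (_ : c *: _ = \pi_quot_mod (c *: x)); last exact: scaleE.
by rewrite [RHS]addE.
Qed.

Lemma quot_pi_eq0 x : \pi_quot_mod x = 0 <-> N x.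
Proof. by rewrite -{2}[x]subr0; apply: iff_sym; apply: quot_piP. Qed.

End QuotientModule.

Section Reduction.
Variables (R : realDomainType) (H : hopfStarAlgType R).
Variables (B A : hopfModStarAlgType H) (V : lmodType (cplx R)).
Variables (l : B -> V -> V) (r : V -> A -> V).
Variables (li : V -> V -> B) (ri : V -> V -> A) (h : H -> V -> V).
Hypothesis bV : prebimodule l r li ri h.
Hypotheses (lspan : spanning l) (rspan : spanning r).
Hypothesis lip_rip :
  forall x y z w, ri (l (li x y) z) w = ri (r x (ri y z)) w.
Hypothesis lfaith : forall b, (forall x y, ri (l b x) y = 0) -> b = 0.
Hypotheses (rcov : rip_cov' ri h) (lcov : lmul_cov l h).
Hypotheses (ndB : nondegenerate_alg B) (ndA : nondegenerate_alg A).
Implicit Types (c : cplx R) (x y z : V) (a : A) (b : B) (g : H).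

Definition degenerate x : Prop := forall y, ri x y = 0.

Fact degenerate0 : degenerate 0.
Proof.
move=> y.
exact: (linear_for0 (V := conjmod A) (fun c x x' => ripPl bV c x x' y)).
Qed.

Fact degenerateP c x y : degenerate x -> degenerate y -> degenerate (c *: x + y).
Proof. by move=> dx dy z; rewrite (ripPl bV) dx dy scaler0 addr0. Qed.

Let N := Submodule degenerate0 degenerateP.
Let Q := quot_mod N.
Let pi : V -> Q := \pi_Q.
Let rho : Q -> V := repr.

Let rhoK : cancel rho pi. Proof. exact: reprK. Qed.
Let pi_lin : linear pi. Proof. exact: quot_pi_linear. Qed.

Let piW (P : Q -> Prop) : (forall x, P (pi x)) -> forall q, P q.
Proof. by move=> Px q; rewrite -[q]rhoK; apply: Px. Qed.

Let pi_eq x x' : (forall y, ri x y = ri x' y) -> pi x = pi x'.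
Proof.
move=> xx'; apply/(quot_piP N) => y /=.
rewrite (linear_forB (V := conjmod A) (f := fun z => ri z y)) ?xx' ?subrr //.
by move=> c z z'; exact: ripPl bV _ _ _ _.
Qed.

Let rip_pil x x' y : pi x = pi x' -> ri x y = ri x' y.
Proof.
move=> /quot_piP /(_ y); rewrite -{2}[x](subrK x') -{2}[x - x']scale1r (ripPl bV).
by move=> ->; rewrite scaler0 add0r.
Qed.

Let rip_pir x y y' : pi y = pi y' -> ri x y = ri x y'.
Proof.
by move=> yy'; rewrite !(rip_herm (pre_rip bV) x); congr star; apply: rip_pil.
Qed.

(** For degenerate u, <<u, y> z, w> = <u <y, z>, w> = <y, z>^* <u, w> = 0, so <u, y> acts as zero
    and vanishes by [lfaith]. *)
Let lip_pil x x' y : pi x = pi x' -> li x y = li x' y.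
Proof.
move=> xx'; apply/eqP; rewrite -subr_eq0; apply/eqP/lfaith => z w.
rewrite -(linear_forB (f := li^~ y)); last by blin bV.
have dxx' : degenerate (x - x') by exact/(quot_piP N).
by rewrite lip_rip (ripMl bV) dxx' (linear_for0 (amul_linr _)).
Qed.

Let lip_pir x y y' : pi y = pi y' -> li x y = li x y'.
Proof.
by move=> yy'; rewrite !(lip_herm (pre_lip bV) x); congr star; apply: lip_pil.
Qed.

(** All operations are evaluated on chosen representatives; independence of the choice is the
    content of the five lemmas [qlE] to [qriE]. *)
Let ql b (q : Q) : Q := pi (l b (rho q)).
Let qr (q : Q) a : Q := pi (r (rho q) a).
Let qli (p q : Q) : B := li (rho p) (rho q).
Let qri (p q : Q) : A := ri (rho p) (rho q).
Let qh g (q : Q) : Q := pi (h g (rho q)).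

Let qlE b x : ql b (pi x) = pi (l b x).
Proof.
apply: pi_eq => y; rewrite !(pre_rip_lmul bV); apply: rip_pil.
exact: rhoK.
Qed.

Let qrE x a : qr (pi x) a = pi (r x a).
Proof.
by apply: pi_eq => y; rewrite !(ripMl bV) (rip_pil y (rhoK _)).
Qed.

(** The antipode-free covariance expresses <y, g x> through pairings with x alone, so g preserves
    degenerate elements. *)
Let qhE g x : qh g (pi x) = pi (h g x).
Proof.
apply: pi_eq => y; rewrite !(rip_herm (pre_rip bV) _ y) !rcov; congr star.
by apply: eq_sweedler => g1 g2; rewrite (rip_pir _ (rhoK _)).
Qed.

Let qliE x y : qli (pi x) (pi y) = li x y.
Proof. by rewrite /qli (lip_pil _ (rhoK _)) (lip_pir _ (rhoK _)). Qed.

Let qriE x y : qri (pi x) (pi y) = ri x y.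
Proof. by rewrite /qri (rip_pil _ (rhoK _)) (rip_pir _ (rhoK _)). Qed.

Fact red_lmodule : left_module ql.
Proof.
split=> [|b b'|e ue].
- split=> [|b c].
    by elim/piW => x c b b'; rewrite !qlE -pi_lin (lmulPl bV).
  by do 2!elim/piW => ?; rewrite -pi_lin !qlE -pi_lin (lmulPr bV).
- by elim/piW => x; rewrite !qlE (lmoduleA (pre_lmodule bV)).
- by elim/piW => x; rewrite qlE (lmodule_unit (pre_lmodule bV)).
Qed.

Fact red_rmodule : right_module qr.
Proof.
split=> [|q a a'|e ue].
- split=> [a c|].
    by do 2!elim/piW => ?; rewrite -pi_lin !qrE -pi_lin (rmulPl bV).
  by elim/piW => x c a a'; rewrite !qrE -pi_lin (rmulPr bV).
- by elim/piW: q => x; rewrite !qrE (rmoduleA (pre_rmodule bV)).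
- by elim/piW => x; rewrite qrE (rmodule_unit (pre_rmodule bV)).
Qed.

Fact red_lip : left_inner_product ql qli.
Proof.
split=> [|b|].
- split; elim/piW => x c; do 2!elim/piW => ?; rewrite -pi_lin !qliE.
    exact: (lipPl bV).
  exact: (lipPr bV).
- by do 2!elim/piW => ?; rewrite qlE !qliE (lip_linear (pre_lip bV)).
- by do 2!elim/piW => ?; rewrite !qliE (lip_herm (pre_lip bV)).
Qed.

Fact red_rip : right_inner_product qr qri.
Proof.
split=> [|p q a|].
- split; elim/piW => x c; do 2!elim/piW => ?; rewrite -pi_lin !qriE.
    exact: (ripPl bV).
  exact: (ripPr bV).
- elim/piW: p => x; elim/piW: q => y.
  by rewrite qrE !qriE (rip_linear (pre_rip bV)).
- by do 2!elim/piW => ?; rewrite !qriE (rip_herm (pre_rip bV)).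
Qed.

Fact red_hmodule : hopf_module qh.
Proof.
split=> [||g g'].
- split=> [|g c].
    by elim/piW => x c g g'; rewrite !qhE -pi_lin (hactPl bV).
  by do 2!elim/piW => ?; rewrite -pi_lin !qhE -pi_lin (hactPr bV).
- by elim/piW => x; rewrite qhE (hact1 bV).
- by elim/piW => x; rewrite !qhE (hactM bV).
Qed.

Lemma red_prebimodule : prebimodule ql qr qli qri qh.
Proof.
split.
- exact: red_lmodule.
- exact: red_rmodule.
- by move=> b; elim/piW => x a; rewrite qlE !qrE qlE (pre_assoc bV).
- exact: red_lip.
- exact: red_rip.
- have S0 := spanned0 qli; have SD := @spanned_lin _ _ _ _ qli.
  apply: (spanning_ind (P := spanned qli) (pre_lip_full bV) S0 SD) => x y.
  by rewrite -qliE; apply: (spanned_gen qli).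
- have S0 := spanned0 qri; have SD := @spanned_lin _ _ _ _ qri.
  apply: (spanning_ind (P := spanned qri) (pre_rip_full bV) S0 SD) => x y.
  by rewrite -qriE; apply: (spanned_gen qri).
- by move=> b; do 2!elim/piW => ?; rewrite !qlE !qriE (pre_rip_lmul bV).
- move=> p a q; elim/piW: p => x; elim/piW: q => y.
  by rewrite !qrE !qliE (pre_lip_rmul bV).
- exact: red_hmodule.
Qed.

Fact red_nondeg : nondegenerate_ip qri.
Proof.
elim/piW => x xP; apply/quot_pi_eq0 => y; rewrite /= -qriE; exact: xP.
Qed.

Fact red_lip_rip p q s : ql (qli p q) s = qr p (qri q s).
Proof.
elim/piW: p => x; elim/piW: q => y; elim/piW: s => z.
by rewrite qliE qriE qlE qrE; apply: pi_eq => w; apply: lip_rip.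
Qed.

Fact red_rip_cov' : rip_cov' qri qh.
Proof.
move=> g; do 2!elim/piW => ?; rewrite qhE qriE rcov.
by apply: eq_sweedler => g1 g2; rewrite qhE qriE.
Qed.

Fact red_lmul_cov : lmul_cov ql qh.
Proof.
move=> g b; elim/piW => x; rewrite qlE qhE lcov (linear_sweedler_out _ _ pi_lin).
by apply: eq_sweedler => g1 g2; rewrite qhE qlE.
Qed.

Lemma red_spanning (X Y X' Y' : Type) (f : X -> Y -> V) (f' : X' -> Y' -> Q) :
  (forall (s : X) (t : Y), exists s' t', pi (f s t) = f' s' t') ->
  spanning f -> spanning f'.
Proof. by apply: (spanning_surj pi_lin) => q; exists (rho q). Qed.

Definition red_bimod : starEquivBimod B A.
Proof.
refine (@StarEquivBimod R H B A Q ql qr qli qri qh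
  red_lmodule red_rmodule (pre_assoc red_prebimodule) _ _ red_lip red_rip _
  red_nondeg (pre_lip_full red_prebimodule) (pre_rip_full red_prebimodule)
  (pre_rip_lmul red_prebimodule) (pre_lip_rmul red_prebimodule)
  red_lip_rip red_hmodule (rip_cov'W red_prebimodule red_rip_cov') _).
- by apply: (red_spanning _ lspan) => b x; exists b, (pi x); rewrite qlE.
- by apply: (red_spanning _ rspan) => x a; exists (pi x), a; rewrite qrE.
(* If <x, y> = 0 in B for all y, then a^* <x, w> = <x a, w> vanishes for a = <y, z>, since x <y, z>
   equals <x, y> z = 0 up to degenerate elements. By fullness it vanishes for all a, and
   nondegeneracy of [A] gives <x, w> = 0. *)
- elim/piW => x xP; apply/quot_pi_eq0 => w /=; apply: ndA; right.
  have lA : linear (fun a => amul a (ri x w)) by exact: amul_linl.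
  suff Sri a : amul (star a) (ri x w) = 0 by move=> a; rewrite -[a]starK.
  rewrite -(ripMl bV); move: a; apply: (spanning_ind (pre_rip_full bV)).
  - rewrite (ripMl bV) star0; exact: (linear_for0 lA).
  - move=> c a a'; rewrite !(ripMl bV) starP lA => -> ->.
    by rewrite scaler0 addr0.
  - move=> y z; rewrite -lip_rip -qliE xP.
    rewrite (linear_for0 (f := l^~ z)); last by blin bV.
    exact: degenerate0.
- apply: (lip_cov_lmul red_prebimodule) => //; first exact: red_lip_rip.
  + exact: rip_cov'W red_prebimodule red_rip_cov'.
  + exact: red_lmul_cov.
  + exact: (rmul_cov_nondeg red_prebimodule red_nondeg red_rip_cov').
Defined.
(** The reduced Gram matrices are, by definition, Gram matrices of representatives. *)
Lemma red_strong :
  completely_positive li -> completely_positive ri -> strong_bimod red_bimod.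
Proof.
move=> cpl cpr; split=> n q.
- exact: (cpl n (fun i => rho (q i))).
- exact: (cpr n (fun i => rho (q i))).
Qed.

End Reduction.

(** * Complete positivity *)

Section CompletePositivity.
Variables (R : realDomainType).

Lemma additive_sum (U V : zmodType) (f : U -> V) : {morph f : x y / x + y} ->
  forall (I : finType) (F : I -> U), f (\sum_i F i) = \sum_i f (F i).
Proof.
move=> fD I F; apply: big_morph => //.
by apply: (addrI (f 0)); rewrite -fD !addr0.
Qed.

Lemma cnonneg_sum (I : finType) (F : I -> cplx R) :
  (forall i, cnonneg (F i)) -> cnonneg (\sum_i F i).
Proof.
move=> F0; elim/big_rec: _ => [|i x _ x0]; first exact: cnonneg0.
exact: cnonnegD.
Qed.

Variables (B A : starAlgType R) (W V : lmodType (cplx R)).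
Variables (p : W -> W -> B) (ip : V -> V -> A).
(** One abstract setting for both inner products of a tensor product: <v, b v'> with [m] the left
    action, and <v b, v'> with m b v = v b^*. *)
Variables (q : V -> B -> V -> A) (m : B -> V -> V).
Hypothesis q_linear : forall v v', linear (fun b => q v b v').
Hypothesis ipDl : forall y, {morph ip^~ y : v v' / v + v'}.
Hypothesis ipDr : forall y, {morph ip y : v v' / v + v'}.
Hypothesis q_square :
  forall b b' v v', q v (amul (star b) b') v' = ip (m b v) (m b' v').

(* A positive functional [w] on M_n(A) pulls back along [q] to a positive
   functional on M_N(B), N = n k, which is then evaluated at the Gram matrix of
   [p]. *)
Lemma completely_positive_comp n k
    (u : 'I_n -> 'I_k -> W) (v : 'I_n -> 'I_k -> V) :
    completely_positive p -> completely_positive ip ->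
  positive_elt (\matrix_(i, j) \sum_a \sum_b
    q (v i a) (p (u i a) (u j b)) (v j b) : mxalg A n).
Proof.
move=> cp cip w w_pos.
pose N := #|{: 'I_n * 'I_k}|.
pose rk i a : 'I_N := enum_rank (i, a).
pose push (b : mxalg B N) : mxalg A n :=
  \matrix_(i, j) \sum_a \sum_a' q (v i a) (b (rk i a) (rk j a')) (v j a').
have push_lin : linear push.
  move=> c b b'; apply/matrixP => i j; rewrite !mxE scaler_sumr -big_split.
  apply: eq_bigr => a _; rewrite scaler_sumr -big_split; apply: eq_bigr => a' _.
  by rewrite /= !mxE; exact: q_linear.
have phi_lin : linear_for *%R (fun b => w (push b)).
  by move=> c b b'; rewrite push_lin linearP.
pose phi : {scalar mxalg B N} := HB.pack (fun b => w (push b))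
  (GRing.isLinear.Build _ _ _ _ (fun b => w (push b)) phi_lin).
have phi_pos : positive_functional phi.
  move=> M; rewrite /=.
  (* Each row g of [M] contributes the Gram matrix of the vectors [z g i], so the image of M^* M is
     a sum of matrices that are positive by complete positivity of [ip]. *)
  pose z g i := \sum_a m (M g (rk i a)) (v i a).
  have -> : push (amul (star M) M) =
      \sum_g (\matrix_(i, j) ip (z g i) (z g j) : mxalg A n).
    apply/matrixP => i j; rewrite summxE !mxE.
    under [RHS]eq_bigr => g _.
      rewrite mxE (additive_sum (ipDl _)).
      under eq_bigr do rewrite (additive_sum (ipDr _)).
      over.
    rewrite [RHS]exchange_big; apply: eq_bigr => a _.
    rewrite [RHS]exchange_big; apply: eq_bigr => b _.
    rewrite mxE (linear_for_sum (q_linear _ _)); apply: eq_bigr => g _.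
    by rewrite mxE q_square.
  rewrite raddf_sum; apply: cnonneg_sum => g; exact: (cip n (z g) w w_pos).
have := cp N (fun t => u (enum_val t).1 (enum_val t).2) phi phi_pos.
rewrite /=; congr (cnonneg (w _)); apply/matrixP => i j; rewrite !mxE.
by apply: eq_bigr => a _; apply: eq_bigr => b _; rewrite mxE !enum_rankK.
Qed.

End CompletePositivity.

(** Shorter presentations are padded by the default 0 ⊗ 0 = 0 up to the longest one: a common length
    [k] is what indexing by 'I_n * 'I_k requires. *)
Lemma tens_family (C : comNzRingType) (U V : lmodType C) n
    (t : 'I_n -> tensor U V) :
  exists k (u : 'I_n -> 'I_k -> U) (v : 'I_n -> 'I_k -> V),
    forall i, t i = \sum_a tens (u i a) (v i a).
Proof.
pose s i := repr (t i); pose k := \max_i size (s i).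
pose nths i (a : 'I_k) := nth (0, 0) (s i) a.
exists k, (fun i a => (nths i a).1), (fun i a => (nths i a).2) => i.
rewrite -[t i]reprK tens_pi -/(s i) (big_nth (0, 0)).
rewrite -(big_mkord xpredT (fun a =>
  tens (nth (0, 0) (s i) a).1 (nth (0, 0) (s i) a).2)).
rewrite [RHS](big_cat_nat (n := size (s i))) //=; last first.
  exact: (@leq_bigmax _ (fun i => size (s i))).
rewrite [X in _ = _ + X]big_nat [X in _ = _ + X]big1 ?addr0 // => a /andP[le_a _].
rewrite nth_default //=; case: (@tens_bilinear C U V) => l _.
exact: (linear_for0 (l 0)).
Qed.

(** * Transitivity: reduced tensor products of bimodules *)

Section Composition.
Variables (R : realDomainType) (H : hopfStarAlgType R).
Variables (D B A : idemNondegAlg H).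
Variables (F : starEquivBimod D B) (E : starEquivBimod B A).

Let bF := bim_prebimodule F.
Let bE := bim_prebimodule E.

(** Four separating tests in a row: d acts faithfully on F, d y is detected by <d y, y'>, this
    element of B acts faithfully on E, and the result is detected by the A-valued inner product,
    which is the star of a value of [tens_rip]. *)
Lemma tens_lmul_faithful (d : D) :
  (forall t t', tens_rip (F := F) (E := E) (tens_lmul d t) t' = 0) -> d = 0.
Proof.
move=> d0; apply: (lmul_faithful bF (@ina_nondegenerate _ _ D)) => y.
apply: (@bim_rip_nondeg _ _ _ _ F) => y'.
apply: (lmul_faithful bE (@ina_nondegenerate _ _ B)) => x'.
apply: (@bim_rip_nondeg _ _ _ _ E) => x.
rewrite (rip_herm (pre_rip bE)) -tens_ripE -tens_lmulE d0; exact: star0.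
Qed.

Definition comp_bimod : starEquivBimod D A :=
  red_bimod (tens_prebimodule F E) (@tens_lspan _ _ _ _ _ F E)
    (@tens_rspan _ _ _ _ _ F E) (@tens_lip_rip _ _ _ _ _ F E)
    tens_lmul_faithful (@tens_rip_cov' _ _ _ _ _ F E)
    (@tens_lmul_cov _ _ _ _ _ F E) (@ina_nondegenerate _ _ D)
    (@ina_nondegenerate _ _ A).

Lemma tens_rip_cp :
  completely_positive (rip F) -> completely_positive (rip E) ->
  completely_positive (@tens_rip _ _ _ _ _ F E).
Proof.
move=> cpF cpE n t; have [k [y [x tE]]] := tens_family t.
have -> : (\matrix_(i, j) tens_rip (t i) (t j) : mxalg A n) = \matrix_(i, j)
    \sum_a \sum_b rip E (x i a) (lmul (rip F (y i a) (y j b)) (x j b)).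
  apply/matrixP => i j; rewrite !mxE !tE.
  rewrite (linear_for_sum (V := conjmod A) (f := fun t' => tens_rip t' _));
    last by move=> c t' t''; exact: tens_ripPl.
  apply: eq_bigr => a _; rewrite (linear_for_sum (f := tens_rip _)); last first.
    by move=> c t' t''; exact: tens_ripPr.
  by apply: eq_bigr => b _; rewrite tens_ripE.
apply: (completely_positive_comp (p := rip F) (ip := rip E)
  (q := fun x b x' => rip E x (lmul b x')) (m := fun b x => lmul b x)) => //.
- by move=> v v'; blin bE.
- move=> z; apply: (linear_forD (V := conjmod A) (f := (rip E)^~ z)) => c u v.
  exact: ripPl bE _ _ _ _.
- by move=> z; apply: linear_forD; blin bE.
- by move=> b b' v v'; rewrite (lmoduleA (pre_lmodule bE)) -(pre_rip_lmul bE).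
Qed.

Lemma tens_lip_cp :
  completely_positive (lip F) -> completely_positive (lip E) ->
  completely_positive (@tens_lip _ _ _ _ _ F E).
Proof.
move=> cpF cpE n t; have [k [y [x tE]]] := tens_family t.
have -> : (\matrix_(i, j) tens_lip (t i) (t j) : mxalg D n) = \matrix_(i, j)
    \sum_a \sum_b lip F (rmul (y i a) (lip E (x i a) (x j b))) (y j b).
  apply/matrixP => i j; rewrite !mxE !tE.
  rewrite (linear_for_sum (f := fun t' => tens_lip t' _));
    last by move=> c t' t''; exact: tens_lipPl.
  apply: eq_bigr => a _; rewrite (linear_for_sum (V := conjmod D) (f := tens_lip _));
    last by move=> c t' t''; exact: tens_lipPr.
  by apply: eq_bigr => b _; rewrite tens_lipE.
apply: (completely_positive_comp (p := lip E) (ip := lip F)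
  (q := fun y b y' => lip F (rmul y b) y') (m := fun b y => rmul y (star b))) => //.
- by move=> v v'; blin bF.
- by move=> z; apply: linear_forD; blin bF.
- move=> z; apply: (linear_forD (V := conjmod D) (f := lip F z)) => c u v.
  exact: lipPr bF _ _ _ _.
- by move=> b b' v v'; rewrite (rmoduleA (pre_rmodule bF)) (pre_lip_rmul bF).
Qed.

Lemma comp_strong : strong_bimod F -> strong_bimod E -> strong_bimod comp_bimod.
Proof.
move=> [cplF cprF] [cplE cprE]; apply: red_strong.
- exact: tens_lip_cp.
- exact: tens_rip_cp.
Qed.

End Composition.

Lemma conj_strong (R : realDomainType) (H : hopfStarAlgType R)
    (B A : hopfModStarAlgType H) (E : starEquivBimod B A) :
  strong_bimod E -> strong_bimod (conj_bimod E).
Proof. by case. Qed.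

(** * Positivity of the isomorphism bimodule, and the equivalence relations *)

Section GramPositivity.
Variables (R : realDomainType) (A : starAlgType R).

(** The matrix is M^* M for the square matrix M with first row x and all other rows zero. *)
Lemma gram_rows_positive n (x : 'I_n -> A) :
  positive_elt (\matrix_(i, j) amul (star (x i)) (x j) : mxalg A n).
Proof.
case: n x => [|n] x w w_pos.
  (* For n = 0 there is no first row, but the only matrix is 0^* 0. *)
  have := w_pos 0; congr (cnonneg (w _)); apply/matrixP; by case.
pose M : mxalg A n.+1 := \matrix_(i, j) (if i == ord0 then x j else 0).
have := w_pos M; congr (cnonneg (w _)); apply/matrixP => i j; rewrite !mxE.
rewrite (bigD1 ord0) //= big1 => [|k /negPf k0]; rewrite !mxE ?eqxx ?addr0 //.
by rewrite k0 (linear_for0 (amul_linr _)).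
Qed.

Lemma gram_cols_positive n (x : 'I_n -> A) :
  positive_elt (\matrix_(i, j) amul (x i) (star (x j)) : mxalg A n).
Proof.
have := gram_rows_positive (fun i => star (x i)); congr positive_elt.
by apply/matrixP => i j; rewrite !mxE starK.
Qed.

End GramPositivity.

Lemma iso_strong (R : realDomainType) (H : hopfStarAlgType R)
    (A B : idemNondegAlg H) (Phi : {linear A -> B}) (Psi : B -> A)
    (isoP : equivariant_star_iso Phi) (PhiK : cancel Phi Psi)
    (PsiK : cancel Psi Phi) :
  strong_bimod (iso_bimod isoP PhiK PsiK).
Proof.
split=> n x; last exact: gram_rows_positive.
have := gram_cols_positive (fun i => Phi (x i)); congr positive_elt.
apply/matrixP => i j; rewrite !mxE /lip /=.
by rewrite (iso_mul isoP) (iso_star isoP).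
Qed.

Lemma iso_strongly_Morita (R : realDomainType) (H : hopfStarAlgType R)
    (A B : idemNondegAlg H) :
  equivariantly_star_isomorphic A B -> strongly_Morita_equivalent A B.
Proof.
move=> [Phi isoP]; have [Psi PhiK PsiK] := iso_bijective isoP.
by exists (iso_bimod isoP PhiK PsiK); apply: iso_strong.
Qed.

Lemma star_isomorphic_refl (R : realDomainType) (H : hopfStarAlgType R)
    (A : hopfModStarAlgType H) : equivariantly_star_isomorphic A A.
Proof. by exists idfun; split=> //; exists id. Qed.

Theorem theorem3p4 (R : realDomainType) (H : hopfStarAlgType R) :
  Equivalence
    (fun A B : idemNondegAlg H => star_Morita_equivalent A B) /\
  Equivalence
    (fun A B : idemNondegAlg H => strongly_Morita_equivalent A B) /\
  (forall A B : idemNondegAlg H, equivariantly_star_isomorphic A B ->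
     strongly_Morita_equivalent A B /\ star_Morita_equivalent A B).
Proof.
have iso (A B : idemNondegAlg H) : equivariantly_star_isomorphic A B ->
    strongly_Morita_equivalent A B /\ star_Morita_equivalent A B.
  by move=> /iso_strongly_Morita sM; split=> //; case: sM => E _; exists.
split; [split | split; [split | exact: iso]].
(* Reflexivity is the isomorphism case for the identity; this is where idempotence enters, through
   [iso_bimod]. *)
- by move=> A; have [_] := iso A A (star_isomorphic_refl A).
- by move=> A B [E]; exists; exact: conj_bimod.
- by move=> A B D [E] [F]; exists; exact: comp_bimod F E.
- by move=> A; have [] := iso A A (star_isomorphic_refl A).
- by move=> A B [E sE]; exists (conj_bimod E); apply: conj_strong.
- by move=> A B D [E sE] [F sF]; exists (comp_bimod F E); apply: comp_strong.
Qed.
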